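(* Let $\mathcal{C}$ be a sovereign monoidal category with coequalizers in which every object is coflat and left robust. Let $R$ be a Frobenius separable algebra (i.e. both Frobenius and separable) in $\mathcal{C}$ and $i:R\to S$ an algebra extension. Then $i:R\to S$ is Frobenius if and only if $S$ is a Frobenius algebra in $\mathcal{C}$ and $\widetilde{\mathcal{N}}\circ i=i\circ\mathcal{N}$, where $\widetilde{\mathcal{N}}$ and $\mathcal{N}$ are the Nakayama automorphisms of $S$ and $R$ associated with some Frobenius pair for $S$ and some Frobenius pair for $R$, respectively.
   Context: Monoidal categories are taken strict, with tensor product $\otimes$ and unit object $\underline{1}$; $m_A,\eta_A$ denote multiplication and unit of an algebra $A$. An object $X$ is coflat if $X\otimes-$ and $-\otimes X$ preserve coequalizers. A left dual $X^*$ of $X$ comes with $\mathrm{ev}_X:X^*\otimes X\to\underline{1}$, $\mathrm{coev}_X:\underline{1}\to X\otimes X^*$ such that $(\mathrm{Id}_X\otimes\mathrm{ev}_X)(\mathrm{coev}_X\otimes\mathrm{Id}_X)=\mathrm{Id}_X$ and $(\mathrm{ev}_X\otimes\mathrm{Id}_{X^*})(\mathrm{Id}_{X^*}\otimes\mathrm{coev}_X)=\mathrm{Id}_{X^*}$; a right dual ${}^*X$ comes with $\mathrm{ev}'_X:X\otimes{}^*X\to\underline{1}$, $\mathrm{coev}'_X:\underline{1}\to{}^*X\otimes X$ such that $(\mathrm{ev}'_X\otimes\mathrm{Id}_X)(\mathrm{Id}_X\otimes\mathrm{coev}'_X)=\mathrm{Id}_X$ and $(\mathrm{Id}_{{}^*X}\otimes\mathrm{ev}'_X)(\mathrm{coev}'_X\otimes\mathrm{Id}_{{}^*X})=\mathrm{Id}_{{}^*X}$.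 A monoidal category is rigid if every object has left and right duals, and sovereign if it is rigid and the left duality functor $(-)^*$ and the right duality functor ${}^*(-)$ coincide; one writes $\widehat X:=X^*={}^*X$. A Frobenius pair for an algebra $A$ is a pair $(\vartheta,e)$ with $\vartheta:A\to\underline{1}$, $e:\underline{1}\to A\otimes A$, $(m_A\otimes\mathrm{Id}_A)(\mathrm{Id}_A\otimes e)=(\mathrm{Id}_A\otimes m_A)(e\otimes\mathrm{Id}_A)$ and $(\vartheta\otimes\mathrm{Id}_A)e=\eta_A=(\mathrm{Id}_A\otimes\vartheta)e$; $A$ is Frobenius if it has one. $A$ is separable if there is an $A$-bimodule morphism $\gamma:A\to A\otimes A$ with $m_A\gamma=\mathrm{Id}_A$. The Nakayama automorphism of a Frobenius algebra $A$ in a sovereign category (with Frobenius pair $(\vartheta,e)$) is $$\mathcal{N}=(\mathrm{ev}_A\otimes\mathrm{Id}_A)(\mathrm{Id}_{\widehat A}\otimes e)(\mathrm{Id}_{\widehat A}\otimes\vartheta m_A)(\mathrm{coev}'_A\otimes\mathrm{Id}_A):A\to A.$$ For a right $R$-module $(X,\nu^R_X)$ and a left $R$-module $(Y,\mu^R_Y)$, $q^R_{X,Y}:X\otimes Y\to X\otimes_RY$ is the coequalizer of $\nu^R_X\otimes\mathrm{Id}_Y$ and $\mathrm{Id}_X\otimes\mu^R_Y$. For $g:X\to X'$ right $R$-linear, $\hat g$ is given by $\hat gq^R_{X,Y}=q^R_{X',Y}(g\otimes\mathrm{Id}_Y)$; for $f:Y\to Y'$ left $R$-linear, $\tilde f$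 is given by $\tilde fq^R_{X,Y}=q^R_{X,Y'}(\mathrm{Id}_X\otimes f)$. The isomorphisms $\Upsilon_X:X\otimes_RR\to X$, $\Upsilon'_Y:R\otimes_RY\to Y$ are determined by $\Upsilon_Xq^R_{X,R}=\nu^R_X$, $\Upsilon'_Yq^R_{R,Y}=\mu^R_Y$. A left $R$-module $Y$ is left robust if for all objects $M$ and right $R$-modules $X$ the morphism $\theta'_{M,X,Y}:(M\otimes X)\otimes_RY\to M\otimes(X\otimes_RY)$ with $\theta'_{M,X,Y}q^R_{M\otimes X,Y}=\mathrm{Id}_M\otimes q^R_{X,Y}$ is an isomorphism; ''every object is left robust'' means this for every algebra $R$ and every left $R$-module. An algebra extension $i:R\to S$ is an algebra morphism; $S$ is an $R$-bimodule via $i$. $S\otimes_RS$ is an $S$-bimodule via $\mu^S_{S\otimes_RS}(\mathrm{Id}_S\otimes q^R_{S,S})=q^R_{S,S}(m_S\otimes\mathrm{Id}_S)$, $\nu^S_{S\otimes_RS}(q^R_{S,S}\otimes\mathrm{Id}_S)=q^R_{S,S}(\mathrm{Id}_S\otimes m_S)$. The extension $i$ is Frobenius if there are an $R$-bimodule morphism $\vartheta':S\to R$ and $e':\underline{1}\to S\otimes_RS$ in $\mathcal{C}$ with $\mu^S_{S\otimes_RS}(\mathrm{Id}_S\otimes e')=\nu^S_{S\otimes_RS}(e'\otimes\mathrm{Id}_S)$, $\widetilde{\vartheta'}e'=\Upsilon_S^{-1}\eta_S$, $\widehat{\vartheta'}e'=\Upsilon'^{-1}_S\eta_S$. *)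

(* Defs.v *)
From Stdlib Require Import ProofIrrelevance IndefiniteDescription.
From mathcomp Require Import ssreflect ssrfun ssrbool.

Set Implicit Arguments.
Unset Strict Implicit.
Unset Printing Implicit Defensive.

Declare Scope cat_scope.
Delimit Scope cat_scope with cat.
Local Open Scope cat_scope.

Record category := Category {
  ob :> Type;
  hom : ob -> ob -> Type;
  idm : forall X, hom X X;
  comp : forall X Y Z, hom Y Z -> hom X Y -> hom X Z;
  compA : forall X Y Z T (h : hom Z T) (g : hom Y Z) (f : hom X Y),
    comp h (comp g f) = comp (comp h g) f;
  comp1m : forall X Y (f : hom X Y), comp (idm Y) f = f;
  compm1 : forall X Y (f : hom X Y), comp f (idm X) = f }.

Arguments hom {c} X Y.
Arguments idm {c} X.
Arguments comp {c X Y Z} g f.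

Notation "g ∘ f" := (comp g f) (at level 50, left associativity) : cat_scope.

Definition is_iso (C : category) (X Y : C) (f : hom X Y) : Prop :=
  exists g : hom Y X, g ∘ f = idm X /\ f ∘ g = idm Y.

Definition is_coequalizer (C : category) (X Y Q : C) (f g : hom X Y)
    (q : hom Y Q) : Prop :=
  q ∘ f = q ∘ g /\
  forall (Z : C) (h : hom Y Z), h ∘ f = h ∘ g -> exists! u : hom Q Z, u ∘ q = h.

Definition desc (C : category) (X Y Q : C) (f g : hom X Y) (q : hom Y Q)
    (H : is_coequalizer f g q) (Z : C) (h : hom Y Z) (e : h ∘ f = h ∘ g) :
  hom Q Z := proj1_sig (constructive_definite_description _ (proj2 H Z h e)).

Lemma descE (C : category) (X Y Q : C) (f g : hom X Y) (q : hom Y Q)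
    (H : is_coequalizer f g q) (Z : C) (h : hom Y Z) (e : h ∘ f = h ∘ g) :
  desc H e ∘ q = h.
Proof. by rewrite /desc; case: constructive_definite_description. Qed.

Lemma coeq_epi (C : category) (X Y Q : C) (f g : hom X Y) (q : hom Y Q)
    (H : is_coequalizer f g q) (Z : C) (u v : hom Q Z) :
  u ∘ q = v ∘ q -> u = v.
Proof.
move=> e; case: H => qfg H.
have e' : (v ∘ q) ∘ f = (v ∘ q) ∘ g by rewrite -!compA qfg.
by case: (H _ _ e') => w [_ wu]; rewrite -(wu u e) -(wu v erefl).
Qed.

Record coequalizers (C : category) := Coequalizers {
  coeq_ob : forall (X Y : C) (f g : hom X Y), C;
  coeq_map : forall (X Y : C) (f g : hom X Y), hom Y (coeq_ob f g);
  coeqP : forall (X Y : C) (f g : hom X Y), is_coequalizer f g (coeq_map f g) }.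

(* The morphism underlying an equality of objects. *)
Definition eqm (C : category) (X Y : C) (e : X = Y) : hom X Y :=
  match e in _ = Z return hom X Z with erefl => idm X end.

(* Strictness is equality of the objects (X ⊗ Y) ⊗ Z and X ⊗ (Y ⊗ Z), and of
   𝟙 ⊗ X, X ⊗ 𝟙 and X; the corresponding equalities between morphisms are
   stated along [eqm]. The pentagon and triangle are then consequences. *)
Record strict_monoidal_category := StrictMonoidalCategory {
  mcat :> category;
  unit_ob : mcat;
  tens : mcat -> mcat -> mcat;
  tensm : forall X X' Y Y' : mcat,
    hom X X' -> hom Y Y' -> hom (tens X Y) (tens X' Y');
  tensm1 : forall X Y, tensm (idm X) (idm Y) = idm (tens X Y);
  tensm_comp : forall (X X' X'' Y Y' Y'' : mcat) (f' : hom X' X'')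
    (f : hom X X') (g' : hom Y' Y'') (g : hom Y Y'),
    tensm (f' ∘ f) (g' ∘ g) = tensm f' g' ∘ tensm f g;
  tensA : forall X Y Z, tens (tens X Y) Z = tens X (tens Y Z);
  tens1X : forall X, tens unit_ob X = X;
  tensX1 : forall X, tens X unit_ob = X;
  tensmA : forall (X X' Y Y' Z Z' : mcat) (f : hom X X') (g : hom Y Y')
    (h : hom Z Z'),
    eqm (tensA X' Y' Z') ∘ tensm (tensm f g) h =
    tensm f (tensm g h) ∘ eqm (tensA X Y Z);
  tensm1f : forall (X X' : mcat) (f : hom X X'),
    eqm (tens1X X') ∘ tensm (idm unit_ob) f = f ∘ eqm (tens1X X);
  tensmf1 : forall (X X' : mcat) (f : hom X X'),
    eqm (tensX1 X') ∘ tensm f (idm unit_ob) = f ∘ eqm (tensX1 X) }.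

Arguments unit_ob {s}.
Arguments tens {s} X Y.
Arguments tensm {s X X' Y Y'} f g.

Notation "𝟙" := unit_ob : cat_scope.
Notation "X ⊗ Y" := (tens X Y) (at level 40, left associativity) : cat_scope.
Notation "f ⊠ g" := (tensm f g) (at level 40, left associativity) : cat_scope.

(* The identifications (X ⊗ Y) ⊗ Z = X ⊗ (Y ⊗ Z), 𝟙 ⊗ X = X and X ⊗ 𝟙 = X as
   morphisms, in both directions. *)
Notation α := (eqm (tensA _ _ _)).
Notation α' := (eqm (esym (tensA _ _ _))).
Notation λ := (eqm (tens1X _)).
Notation λ' := (eqm (esym (tens1X _))).
Notation ρ := (eqm (tensX1 _)).
Notation ρ' := (eqm (esym (tensX1 _))).

Section EqmTheory.
Variable C : category.

Lemma eqm_irr (X Y : C) (e e' : X = Y) : eqm e = eqm e'.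
Proof. by rewrite (proof_irrelevance _ e e'). Qed.

Lemma eqm_comp (X Y Z : C) (e' : Y = Z) (e : X = Y) :
  eqm e' ∘ eqm e = eqm (etrans e e').
Proof. by case: Z / e'; rewrite comp1m; apply: eqm_irr. Qed.

Lemma eqmK (X Y : C) (e : X = Y) (e' : Y = X) : eqm e' ∘ eqm e = idm X.
Proof. by rewrite eqm_comp (eqm_irr _ erefl). Qed.

End EqmTheory.

Section MonoidalTheory.
Variable C : strict_monoidal_category.
Implicit Types X Y Z : C.

Lemma tens1eqm X Y Z (e : Y = Z) :
  idm X ⊠ eqm e = eqm (congr1 (tens X) e).
Proof. by case: Z / e => /=; rewrite tensm1. Qed.

Lemma tenseqm1 X Y Z (e : Y = Z) :
  eqm e ⊠ idm X = eqm (congr1 (fun T => tens T X) e).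
Proof. by case: Z / e => /=; rewrite tensm1. Qed.

Lemma tensmA' X X' Y Y' Z Z' (f : hom X X') (g : hom Y Y') (h : hom Z Z') :
  α' ∘ (f ⊠ (g ⊠ h)) = ((f ⊠ g) ⊠ h) ∘ α'.
Proof.
rewrite -[LHS]compm1 -(eqmK (esym (tensA X Y Z)) (tensA X Y Z)).
by rewrite compA -(compA _ _ α) -tensmA !compA eqmK comp1m.
Qed.

Lemma tens1_comp X Y Y' Y'' (g : hom Y' Y'') (f : hom Y Y') :
  idm X ⊠ (g ∘ f) = (idm X ⊠ g) ∘ (idm X ⊠ f).
Proof. by rewrite -tensm_comp comp1m. Qed.

Lemma tens_comp1 X Y Y' Y'' (g : hom Y' Y'') (f : hom Y Y') :
  (g ∘ f) ⊠ idm X = (g ⊠ idm X) ∘ (f ⊠ idm X).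
Proof. by rewrite -tensm_comp comp1m. Qed.

Lemma tens_swap X X' Y Y' (f : hom X X') (g : hom Y Y') :
  (f ⊠ idm Y') ∘ (idm X ⊠ g) = (idm X' ⊠ g) ∘ (f ⊠ idm Y).
Proof. by rewrite -!tensm_comp !comp1m !compm1. Qed.

Lemma lact_descent (S R Q : C) (m : hom (S ⊗ S) S) (r : hom (S ⊗ R) S)
    (a : hom (R ⊗ S) S) (q : hom (S ⊗ S) Q) :
  m ∘ (idm S ⊠ r) ∘ α = r ∘ (m ⊠ idm R) ->
  q ∘ (r ⊠ idm S) = q ∘ ((idm S ⊠ a) ∘ α) ->
  q ∘ (m ⊠ idm S) ∘ α' ∘ (idm S ⊠ (r ⊠ idm S)) =
  q ∘ (m ⊠ idm S) ∘ α' ∘ (idm S ⊠ ((idm S ⊠ a) ∘ α)).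
Proof.
move=> e qE.
have e' : m ∘ (idm S ⊠ r) = r ∘ (m ⊠ idm R) ∘ α'.
  by rewrite -e -[RHS]compA eqmK compm1.
rewrite -!compA tensmA' (compA (m ⊠ idm S)) -tens_comp1 e'.
rewrite !tens_comp1 !compA qE -!compA; congr (comp q).
rewrite tens1_comp (compA α' (idm S ⊠ (idm S ⊠ a))) tensmA' tensm1.
rewrite !compA tens_swap -!compA; congr (comp _).
rewrite (compA α) tensmA tensm1 -!compA; congr (comp _).
by rewrite tenseqm1 tens1eqm !eqm_comp; apply: eqm_irr.
Qed.

Lemma ract_descent (S R Q : C) (m : hom (S ⊗ S) S) (r : hom (S ⊗ R) S)
    (a : hom (R ⊗ S) S) (q : hom (S ⊗ S) Q) :
  m ∘ (a ⊠ idm S) = a ∘ (idm R ⊠ m) ∘ α ->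
  q ∘ (r ⊠ idm S) = q ∘ ((idm S ⊠ a) ∘ α) ->
  q ∘ (idm S ⊠ m) ∘ α ∘ ((r ⊠ idm S) ⊠ idm S) =
  q ∘ (idm S ⊠ m) ∘ α ∘ (((idm S ⊠ a) ∘ α) ⊠ idm S).
Proof.
move=> e qE.
rewrite -!compA tensmA tensm1 (compA (idm S ⊠ m)) -tens_swap !compA qE.
rewrite tens_comp1 -!compA; congr (comp q).
rewrite (compA α (idm S ⊠ a ⊠ idm S)) tensmA.
rewrite !compA -tens1_comp e !tens1_comp -!compA; congr (comp _).
rewrite -tensm1 (compA α) tensmA -!compA; congr (comp _).
by rewrite tenseqm1 tens1eqm !eqm_comp; apply: eqm_irr.
Qed.

End MonoidalTheory.

Record left_dual (C : strict_monoidal_category) (X D : C) := LeftDual {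
  ev : hom (D ⊗ X) 𝟙;
  coev : hom 𝟙 (X ⊗ D);
  ev_coevX : ρ ∘ (idm X ⊠ ev) ∘ α ∘ (coev ⊠ idm X) ∘ λ' = idm X;
  ev_coevD : λ ∘ (ev ⊠ idm D) ∘ α' ∘ (idm D ⊠ coev) ∘ ρ' = idm D }.

Record right_dual (C : strict_monoidal_category) (X D : C) := RightDual {
  evr : hom (X ⊗ D) 𝟙;
  coevr : hom 𝟙 (D ⊗ X);
  evr_coevrX : λ ∘ (evr ⊠ idm X) ∘ α' ∘ (idm X ⊠ coevr) ∘ ρ' = idm X;
  evr_coevrD : ρ ∘ (idm D ⊠ evr) ∘ α ∘ (coevr ⊠ idm D) ∘ λ' = idm D }.

(* Action on morphisms of the duality functors, for chosen duals. *)
Definition left_transpose (C : strict_monoidal_category) (X X' D D' : C)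
    (d : left_dual X D) (d' : left_dual X' D') (f : hom X X') : hom D' D :=
  λ ∘ (ev d' ⊠ idm D) ∘ ((idm D' ⊠ f) ⊠ idm D) ∘ α' ∘
  (idm D' ⊠ coev d) ∘ ρ'.

Definition right_transpose (C : strict_monoidal_category) (X X' D D' : C)
    (d : right_dual X D) (d' : right_dual X' D') (f : hom X X') : hom D' D :=
  ρ ∘ (idm D ⊠ evr d') ∘ (idm D ⊠ (f ⊠ idm D')) ∘ α ∘
  (coevr d ⊠ idm D') ∘ λ'.

(* Rigidity together with equality of the two duality functors: the same object
   [hat X] is a left and a right dual of X, and the functors agree on
   morphisms. *)
Record sovereign (C : strict_monoidal_category) := Sovereign {
  hat : C -> C;
  hat_left : forall X, left_dual X (hat X);
  hat_right : forall X, right_dual X (hat X);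
  hat_morE : forall (X X' : C) (f : hom X X'),
    left_transpose (hat_left X) (hat_left X') f =
    right_transpose (hat_right X) (hat_right X') f }.

Record algebra (C : strict_monoidal_category) := Algebra {
  alg_ob :> C;
  mul : hom (alg_ob ⊗ alg_ob) alg_ob;
  eta : hom 𝟙 alg_ob;
  mulA : mul ∘ (mul ⊠ idm alg_ob) = mul ∘ (idm alg_ob ⊠ mul) ∘ α;
  mul1m : mul ∘ (eta ⊠ idm alg_ob) = λ;
  mulm1 : mul ∘ (idm alg_ob ⊠ eta) = ρ }.

Arguments mul {C} a.
Arguments eta {C} a.

Record algebra_morphism (C : strict_monoidal_category) (R S : algebra C) :=
  AlgebraMorphism {
    alg_hom :> hom R S;
    alg_homM : alg_hom ∘ mul R = mul S ∘ (alg_hom ⊠ alg_hom);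
    alg_hom1 : alg_hom ∘ eta R = eta S }.

Record left_module (C : strict_monoidal_category) (R : algebra C) :=
  LeftModule {
    lmod_ob :> C;
    lact : hom (R ⊗ lmod_ob) lmod_ob;
    lactA : lact ∘ (mul R ⊠ idm lmod_ob) = lact ∘ (idm R ⊠ lact) ∘ α;
    lact1 : lact ∘ (eta R ⊠ idm lmod_ob) = λ }.

Record right_module (C : strict_monoidal_category) (R : algebra C) :=
  RightModule {
    rmod_ob :> C;
    ract : hom (rmod_ob ⊗ R) rmod_ob;
    ractA : ract ∘ (ract ⊠ idm R) = ract ∘ (idm rmod_ob ⊠ mul R) ∘ α;
    ract1 : ract ∘ (idm rmod_ob ⊠ eta R) = ρ }.

Arguments lact {C R} l.
Arguments ract {C R} r.

Definition left_linear (C : strict_monoidal_category) (R : algebra C)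
    (Y Y' : left_module R) (f : hom Y Y') : Prop :=
  f ∘ lact Y = lact Y' ∘ (idm R ⊠ f).

Definition right_linear (C : strict_monoidal_category) (R : algebra C)
    (X X' : right_module R) (f : hom X X') : Prop :=
  f ∘ ract X = ract X' ∘ (f ⊠ idm R).

Section Modules.
Variable C : strict_monoidal_category.

Definition left_regular (R : algebra C) : left_module R :=
  LeftModule (mulA R) (mul1m R).

Definition right_regular (R : algebra C) : right_module R :=
  RightModule (mulA R) (mulm1 R).

Section Restriction.
Variables (R S : algebra C) (i : algebra_morphism R S).

Lemma left_restrictionA (Y : left_module S) (a := lact Y ∘ (i ⊠ idm Y)) :
  a ∘ (mul R ⊠ idm Y) = a ∘ (idm R ⊠ a) ∘ α.
Proof.
rewrite /a -compA -tens_comp1 alg_homM tens_comp1 compA lactA.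
rewrite tens1_comp -!compA tensmA; congr (_ ∘ _); rewrite !compA.
by congr (_ ∘ _); rewrite -!tensm_comp !comp1m !compm1.
Qed.

Lemma left_restriction1 (Y : left_module S) :
  lact Y ∘ (i ⊠ idm Y) ∘ (eta R ⊠ idm Y) = λ.
Proof. by rewrite -compA -tens_comp1 alg_hom1 lact1. Qed.

Definition left_restriction (Y : left_module S) : left_module R :=
  LeftModule (left_restrictionA Y) (left_restriction1 Y).

Lemma right_restrictionA (X : right_module S) (a := ract X ∘ (idm X ⊠ i)) :
  a ∘ (a ⊠ idm R) = a ∘ (idm X ⊠ mul R) ∘ α.
Proof.
rewrite /a -(compA _ _ (idm X ⊠ mul R)) -tens1_comp alg_homM tens1_comp.
rewrite compA -(compA _ _ α) -tensmA compA -ractA -!compA; congr (_ ∘ _).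
by rewrite -!tensm_comp !comp1m compm1.
Qed.

Lemma right_restriction1 (X : right_module S) :
  ract X ∘ (idm X ⊠ i) ∘ (idm X ⊠ eta R) = ρ.
Proof. by rewrite -compA -tens1_comp alg_hom1 ract1. Qed.

Definition right_restriction (X : right_module S) : right_module R :=
  RightModule (right_restrictionA X) (right_restriction1 X).

End Restriction.

Section Tensor.
Variable R : algebra C.

Lemma left_tensorA (Y : left_module R) (M : C)
    (a := (lact Y ⊠ idm M) ∘ α') :
  a ∘ (mul R ⊠ idm (Y ⊗ M)) = a ∘ (idm R ⊠ a) ∘ α.
Proof.
rewrite /a -tensm1 -compA tensmA' compA -tens_comp1 lactA !tens_comp1.
rewrite tens1_comp -!compA; congr (_ ∘ _).
rewrite (compA α') tensmA' -!compA; congr (_ ∘ _).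
by rewrite tenseqm1 tens1eqm !eqm_comp; apply: eqm_irr.
Qed.

Lemma left_tensor1 (Y : left_module R) (M : C) :
  (lact Y ⊠ idm M) ∘ α' ∘ (eta R ⊠ idm (Y ⊗ M)) = λ.
Proof.
rewrite -tensm1 -compA tensmA' compA -tens_comp1 lact1 tenseqm1 eqm_comp.
exact: eqm_irr.
Qed.

Definition left_tensor (Y : left_module R) (M : C) : left_module R :=
  LeftModule (left_tensorA Y M) (left_tensor1 Y M).

Lemma right_tensorA (M : C) (X : right_module R)
    (a := (idm M ⊠ ract X) ∘ α) :
  a ∘ (a ⊠ idm R) = a ∘ (idm (M ⊗ X) ⊠ mul R) ∘ α.
Proof.
rewrite /a -tensm1 -(compA _ _ (idm M ⊠ idm X ⊠ mul R)) tensmA compA.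
rewrite -tens1_comp tens_comp1 -!compA (compA α) tensmA !compA.
rewrite -tens1_comp ractA !tens1_comp -!compA; do 2!congr (_ ∘ _).
by rewrite tenseqm1 tens1eqm !eqm_comp; apply: eqm_irr.
Qed.

Lemma right_tensor1 (M : C) (X : right_module R) :
  (idm M ⊠ ract X) ∘ α ∘ (idm (M ⊗ X) ⊠ eta R) = ρ.
Proof.
rewrite -tensm1 -compA tensmA compA -tens1_comp ract1 tens1eqm eqm_comp.
exact: eqm_irr.
Qed.

Definition right_tensor (M : C) (X : right_module R) : right_module R :=
  RightModule (right_tensorA M X) (right_tensor1 M X).

End Tensor.

End Modules.

Record frobenius_pair (C : strict_monoidal_category) (A : algebra C) :=
  FrobeniusPair {
    fform : hom A 𝟙;
    felt : hom 𝟙 (A ⊗ A);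
    felt_casimir : (mul A ⊠ idm A) ∘ α' ∘ (idm A ⊠ felt) ∘ ρ' =
                   (idm A ⊠ mul A) ∘ α ∘ (felt ⊠ idm A) ∘ λ';
    fform_feltl : λ ∘ (fform ⊠ idm A) ∘ felt = eta A;
    fform_feltr : ρ ∘ (idm A ⊠ fform) ∘ felt = eta A }.

Definition frobenius (C : strict_monoidal_category) (A : algebra C) : Prop :=
  inhabited (frobenius_pair A).

Definition separable (C : strict_monoidal_category) (A : algebra C) : Prop :=
  exists gamma : hom A (A ⊗ A),
    [/\ left_linear (Y := left_regular A)
                    (Y' := left_tensor (left_regular A) A) gamma,
        right_linear (X := right_regular A)
                     (X' := right_tensor A (right_regular A)) gamma
      & mul A ∘ gamma = idm A].

Definition nakayama (C : strict_monoidal_category) (sv : sovereign C)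
    (A : algebra C) (p : frobenius_pair A) : hom A A :=
  let D := hat sv A in
  λ ∘ (ev (hat_left sv A) ⊠ idm A) ∘ α' ∘ (idm D ⊠ felt p) ∘ ρ' ∘
  ρ ∘ (idm D ⊠ (fform p ∘ mul A)) ∘ α ∘ (coevr (hat_right sv A) ⊠ idm A) ∘ λ'.

Definition coflat (C : strict_monoidal_category) (X : C) : Prop :=
  forall (Y Z Q : C) (f g : hom Y Z) (q : hom Z Q), is_coequalizer f g q ->
    is_coequalizer (idm X ⊠ f) (idm X ⊠ g) (idm X ⊠ q) /\
    is_coequalizer (f ⊠ idm X) (g ⊠ idm X) (q ⊠ idm X).

Section TensorOver.
Variables (C : strict_monoidal_category) (cq : coequalizers C).

Section Basics.
Variable R : algebra C.
Implicit Types (X : right_module R) (Y : left_module R).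

Definition tensR_l X Y : hom (X ⊗ R ⊗ Y) (X ⊗ Y) := ract X ⊠ idm Y.
Definition tensR_r X Y : hom (X ⊗ R ⊗ Y) (X ⊗ Y) := (idm X ⊠ lact Y) ∘ α.

Definition tensR X Y : C := coeq_ob cq (tensR_l X Y) (tensR_r X Y).

Definition tensRq X Y : hom (X ⊗ Y) (tensR X Y) :=
  coeq_map cq (tensR_l X Y) (tensR_r X Y).

Lemma tensRqP X Y : is_coequalizer (tensR_l X Y) (tensR_r X Y) (tensRq X Y).
Proof. exact: coeqP. Qed.

Lemma tensRqE X Y :
  tensRq X Y ∘ (ract X ⊠ idm Y) = tensRq X Y ∘ ((idm X ⊠ lact Y) ∘ α).
Proof. exact: (proj1 (tensRqP X Y)). Qed.

Lemma tensR_mapl_subproof X X' Y (g : hom X X') (gP : right_linear g) :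
  tensRq X' Y ∘ (g ⊠ idm Y) ∘ tensR_l X Y =
  tensRq X' Y ∘ (g ⊠ idm Y) ∘ tensR_r X Y.
Proof.
rewrite /tensR_l /tensR_r -!compA -tens_comp1 gP tens_comp1 compA tensRqE.
rewrite -!compA; congr (_ ∘ _); rewrite tensmA !compA; congr (_ ∘ _).
by rewrite -!tensm_comp tensm1 !comp1m !compm1.
Qed.

(* The morphism written with a hat: g ⊗_R Y. *)
Definition tensR_mapl X X' Y (g : hom X X') (gP : right_linear g) :
  hom (tensR X Y) (tensR X' Y) := desc (tensRqP X Y) (tensR_mapl_subproof Y gP).

Lemma tensR_mapr_subproof X Y Y' (f : hom Y Y') (fP : left_linear f) :
  tensRq X Y' ∘ (idm X ⊠ f) ∘ tensR_l X Y =
  tensRq X Y' ∘ (idm X ⊠ f) ∘ tensR_r X Y.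
Proof.
rewrite /tensR_l /tensR_r -!compA (compA (idm X ⊠ f)) -tens1_comp fP.
rewrite tens1_comp -compA -tensmA tensm1 -tens_swap compA tensRqE -!compA.
by [].
Qed.

(* The morphism written with a tilde: X ⊗_R f. *)
Definition tensR_mapr X Y Y' (f : hom Y Y') (fP : left_linear f) :
  hom (tensR X Y) (tensR X Y') := desc (tensRqP X Y) (tensR_mapr_subproof X fP).

Lemma upsilon_subproof X :
  ract X ∘ tensR_l X (left_regular R) = ract X ∘ tensR_r X (left_regular R).
Proof. by rewrite /tensR_l /tensR_r compA ractA. Qed.

Definition upsilon X : hom (tensR X (left_regular R)) X :=
  desc (tensRqP X (left_regular R)) (upsilon_subproof X).

Definition upsilon_inv X : hom X (tensR X (left_regular R)) :=
  tensRq X (left_regular R) ∘ (idm X ⊠ eta R) ∘ ρ'.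

Lemma upsilon_invK X : upsilon X ∘ upsilon_inv X = idm X.
Proof. by rewrite /upsilon_inv !compA descE ract1 eqmK. Qed.

Lemma upsilonK X :
  upsilon_inv X ∘ upsilon X = idm (tensR X (left_regular R)).
Proof.
apply: (coeq_epi (tensRqP X (left_regular R))); rewrite -compA descE comp1m.
set q := tensRq _ _; rewrite /upsilon_inv -/q -compA.
have qE : q ∘ (ract X ⊠ idm R) = q ∘ ((idm X ⊠ mul R) ∘ α).
  exact: (tensRqE X (left_regular R)).
have ->: ρ' ∘ ract X = (ract X ⊠ idm 𝟙) ∘ ρ'.
  rewrite -[RHS]comp1m -(eqmK (tensX1 X) (esym (tensX1 X))) -!compA.
  by rewrite (compA ρ) tensmf1 -compA eqmK compm1.
rewrite -compA (compA (idm X ⊠ eta R)) -tens_swap !compA qE.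
rewrite -tensm1 -!compA (compA α) tensmA !compA -(compA q) -tens1_comp mulm1.
rewrite tens1eqm -!compA !eqm_comp.
by rewrite (eqm_irr _ erefl) compm1.
Qed.

Lemma upsilon'_subproof Y :
  lact Y ∘ tensR_l (right_regular R) Y = lact Y ∘ tensR_r (right_regular R) Y.
Proof. by rewrite /tensR_l /tensR_r compA lactA. Qed.

Definition upsilon' Y : hom (tensR (right_regular R) Y) Y :=
  desc (tensRqP (right_regular R) Y) (upsilon'_subproof Y).

Definition upsilon'_inv Y : hom Y (tensR (right_regular R) Y) :=
  tensRq (right_regular R) Y ∘ (eta R ⊠ idm Y) ∘ λ'.

Lemma upsilon'_invK Y : upsilon' Y ∘ upsilon'_inv Y = idm Y.
Proof. by rewrite /upsilon'_inv !compA descE lact1 eqmK. Qed.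

Lemma upsilon'K Y :
  upsilon'_inv Y ∘ upsilon' Y = idm (tensR (right_regular R) Y).
Proof.
apply: (coeq_epi (tensRqP (right_regular R) Y)); rewrite -compA descE comp1m.
set q := tensRq _ _; rewrite /upsilon'_inv -/q -compA.
have qE : q ∘ (mul R ⊠ idm Y) = q ∘ ((idm R ⊠ lact Y) ∘ α).
  exact: (tensRqE (right_regular R) Y).
have ->: λ' ∘ lact Y = (idm 𝟙 ⊠ lact Y) ∘ λ'.
  rewrite -[RHS]comp1m -(eqmK (tens1X Y) (esym (tens1X Y))) -!compA.
  by rewrite (compA λ) tensm1f -compA eqmK compm1.
rewrite -compA (compA (eta R ⊠ idm Y)) tens_swap.
have e : idm R ⊠ lact Y = (idm R ⊠ lact Y) ∘ α ∘ α'.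
  by rewrite -compA eqmK compm1.
rewrite {1}e !compA -(compA q _ α) -qE -!compA (compA α').
rewrite -tensm1 tensmA' -!compA (compA (mul R ⊠ _)) -tens_comp1 mul1m.
by rewrite tenseqm1 !eqm_comp (eqm_irr _ erefl) compm1.
Qed.

Lemma theta'_subproof (M : C) X Y :
  (idm M ⊠ tensRq X Y) ∘ α ∘ tensR_l (right_tensor M X) Y =
  (idm M ⊠ tensRq X Y) ∘ α ∘ tensR_r (right_tensor M X) Y.
Proof.
rewrite /tensR_l /tensR_r /= tens_comp1 -!compA (compA α) tensmA !compA.
rewrite -tens1_comp tensRqE tens1_comp tens1_comp -!compA; congr (_ ∘ _).
rewrite -tensm1 (compA α (idm M ⊠ idm X ⊠ lact Y)) tensmA -!compA.
congr (_ ∘ _); rewrite tens1eqm tenseqm1 !eqm_comp; exact: eqm_irr.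
Qed.

Definition theta' (M : C) X Y :
  hom (tensR (right_tensor M X) Y) (M ⊗ tensR X Y) :=
  desc (tensRqP (right_tensor M X) Y) (theta'_subproof M X Y).

Definition left_robust Y : Prop :=
  forall (M : C) X, is_iso (theta' M X Y).

End Basics.

Section Extension.
Hypothesis cofl : forall X : C, coflat X.
Variables (R S : algebra C) (i : algebra_morphism R S).

Notation lS := (left_restriction i (left_regular S)).
Notation rS := (right_restriction i (right_regular S)).
Notation SS := (tensR rS lS).
Notation q := (tensRq rS lS).

Lemma ext_lact_subproof :
  q ∘ (mul S ⊠ idm S) ∘ α' ∘ (idm S ⊠ tensR_l rS lS) =
  q ∘ (mul S ⊠ idm S) ∘ α' ∘ (idm S ⊠ tensR_r rS lS).
Proof.
apply: lact_descent (tensRqE rS lS).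
rewrite /= tens1_comp compA -compA -tensmA compA -mulA tensm1 -!compA.
by congr (comp _); rewrite tens_swap.
Qed.

Lemma ext_ract_subproof :
  q ∘ (idm S ⊠ mul S) ∘ α ∘ (tensR_l rS lS ⊠ idm S) =
  q ∘ (idm S ⊠ mul S) ∘ α ∘ (tensR_r rS lS ⊠ idm S).
Proof.
apply: ract_descent (tensRqE rS lS).
rewrite /= tens_comp1 compA mulA -(compA _ α) tensmA compA tensm1.
by rewrite -(compA (mul S)) -tens_swap compA.
Qed.

(* Descent along S ⊗ q and q ⊗ S, which are coequalizers by coflatness. *)
Definition ext_lact : hom (S ⊗ SS) SS :=
  desc (proj1 (cofl S (tensRqP rS lS))) ext_lact_subproof.

Definition ext_ract : hom (SS ⊗ S) SS :=
  desc (proj2 (cofl S (tensRqP rS lS))) ext_ract_subproof.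

Definition frobenius_extension : Prop :=
  exists (th : hom S R)
    (thl : left_linear (Y := lS) (Y' := left_regular R) th)
    (thr : right_linear (X := rS) (X' := right_regular R) th)
    (e : hom 𝟙 SS),
    [/\ ext_lact ∘ (idm S ⊠ e) ∘ ρ' = ext_ract ∘ (e ⊠ idm S) ∘ λ',
        tensR_mapr rS thl ∘ e = upsilon_inv rS ∘ eta S
      & tensR_mapl lS thr ∘ e = upsilon'_inv lS ∘ eta S].

End Extension.

End TensorOver.

(* Main.v *)
(** Write e_R = Σ a ⊗ b and e_S = Σ c ⊗ d.  If (ϑ', e') makes S/R Frobenius,
    then ϑ_R ϑ' and the image of e' under x ⊗_R y ↦ Σ x a ⊗ b y form a Frobenius
    pair of S.  It satisfies ϑ_S(x r) = ϑ_R(ϑ'(x) r) and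
    Σ ϑ'(c) ⊗ d = Σ a ⊗ b; as the left and right transposes of ϑ' agree, this
    gives N_S i = i N_R.

    Conversely, ϑ'(x) := Σ ϑ_S(x a) b is right R-linear and
    ϑ_R(ϑ'(x) r) = ϑ_S(x r).  Since N_R is invertible, N_S i = i N_R turns this
    identity into ϑ_R(r ϑ'(x)) = ϑ_S(r x), so that ϑ' is also left R-linear.
    If Σ a ⊗ w b, with w : 𝟙 → R, is the separability element of R, then e' is
    the class of Σ c ⊗ w d in S ⊗_R S.  The two counit conditions both reduce to
    m_R applied to the separability element being the unit. *)
From mathcomp Require Import ssreflect ssrfun ssrbool seq.
Require Import Defs.

Set Implicit Arguments.
Unset Strict Implicit.
Unset Printing Implicit Defensive.

Local Open Scope cat_scope.

(** * Equality of morphisms up to the identifications of a strict monoidal category *)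

Section Heq.
Variable C : strict_monoidal_category.

(** Strictness is a propositional equality of objects, so the two sides of a law may have different
    types. This relation absorbs the resulting [eqm]; by proof irrelevance the choice of [eX] and
    [eY] does not matter. *)
Definition heq (X Y X' Y' : C) (f : hom X Y) (g : hom X' Y') : Prop :=
  exists (eX : X = X') (eY : Y = Y'), eqm eY ∘ f = g ∘ eqm eX.

Notation "f ≈ g" := (heq f g) (at level 70).

Lemma heq_eq (X Y : C) (f g : hom X Y) : f ≈ g -> f = g.
Proof.
by case=> eX [eY]; rewrite !(eqm_irr _ erefl) comp1m compm1.
Qed.

Lemma eq_heq (X Y : C) (f g : hom X Y) : f = g -> f ≈ g.
Proof. by move=> ->; exists erefl, erefl; rewrite comp1m compm1. Qed.

Lemma heq_refl (X Y : C) (f : hom X Y) : f ≈ f.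
Proof. exact: eq_heq. Qed.

Lemma heq_sym (X Y X' Y' : C) (f : hom X Y) (g : hom X' Y') :
  f ≈ g -> g ≈ f.
Proof.
case=> eX [eY]; case: X' / eX g => g; case: Y' / eY g => g /=.
by rewrite comp1m compm1 => ->; apply: heq_refl.
Qed.

Lemma heq_trans (X Y X' Y' X'' Y'' : C) (f : hom X Y) (g : hom X' Y')
    (h : hom X'' Y'') : f ≈ g -> g ≈ h -> f ≈ h.
Proof.
case=> eX [eY]; case: X' / eX g => g; case: Y' / eY g => g /=.
by rewrite comp1m compm1 => ->.
Qed.

Lemma heq_comp (X Y Z X' Y' Z' : C) (f : hom X Y) (g : hom Y Z)
    (f' : hom X' Y') (g' : hom Y' Z') : g ≈ g' -> f ≈ f' -> g ∘ f ≈ g' ∘ f'.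
Proof.
case=> eX [eY E] [eX' [eY' E']]; move: E E'.
case: X' / eX' f' => f'; case: Z' / eY g' => g'.
case: Y' / eX f' g' eY' => f' g' eY'; rewrite (eqm_irr eY' erefl) /=.
by rewrite !comp1m !compm1 => -> ->; apply: heq_refl.
Qed.

Lemma heq_tens (X Y Z T X' Y' Z' T' : C) (f : hom X Y) (g : hom Z T)
    (f' : hom X' Y') (g' : hom Z' T') : f ≈ f' -> g ≈ g' -> f ⊠ g ≈ f' ⊠ g'.
Proof.
case=> eX [eY E] [eX' [eY' E']]; move: E E'.
case: X' / eX f' => f'; case: Y' / eY f' => f'.
case: Z' / eX' g' => g'; case: T' / eY' g' => g' /=.
by rewrite !comp1m !compm1 => -> ->; apply: heq_refl.
Qed.

Lemma heq_idm (X X' : C) : X = X' -> idm X ≈ idm X'.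
Proof. by move=> ->; apply: heq_refl. Qed.

Lemma heq_eqml (X Y Z : C) (e : Y = Z) (f : hom X Y) : eqm e ∘ f ≈ f.
Proof. by case: Z / e; rewrite comp1m; apply: heq_refl. Qed.

Lemma heq_eqmr (X Y Z : C) (e : X = Y) (f : hom Y Z) : f ∘ eqm e ≈ f.
Proof. by case: Y / e f => f; rewrite compm1; apply: heq_refl. Qed.

Lemma heq_eqm_dom (X Y : C) (e : X = Y) : eqm e ≈ idm X.
Proof. by case: Y / e; apply: heq_refl. Qed.

Lemma heq_eqm_cod (X Y : C) (e : X = Y) : eqm e ≈ idm Y.
Proof. by case: Y / e; apply: heq_refl. Qed.

Lemma heq_tensA (X X' Y Y' Z Z' : C) (f : hom X X') (g : hom Y Y')
  (h : hom Z Z') : (f ⊠ g) ⊠ h ≈ f ⊠ (g ⊠ h).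
Proof. by eexists; eexists; apply: tensmA. Qed.

Lemma heq_tens1f (X X' : C) (f : hom X X') : idm 𝟙 ⊠ f ≈ f.
Proof. by eexists; eexists; apply: tensm1f. Qed.

Lemma heq_tensf1 (X X' : C) (f : hom X X') : f ⊠ idm 𝟙 ≈ f.
Proof. by eexists; eexists; apply: tensmf1. Qed.

End Heq.

Notation "f ≈ g" := (heq f g) (at level 70) : cat_scope.

(** * String diagrams over words of objects *)

Section Words.
Variable C : strict_monoidal_category.
Implicit Types (l r s a b : seq C) (T : C).

(* Tensor product of a list of objects; a one-letter word is the letter itself,
   so that structure maps such as [mul A] have types [whom a b] by conversion. *)
Fixpoint wob s : C :=
  match s with
  | [::] => 𝟙
  | y :: s' => match s' with [::] => y | _ => y ⊗ wob s' end
  end.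

Definition whom a b := hom (wob a) (wob b).

Lemma wob_cons y s : y ⊗ wob s = wob (y :: s).
Proof. by case: s => //; apply: tensX1. Qed.

Lemma wob_cat a b : wob a ⊗ wob b = wob (a ++ b).
Proof.
elim: a => [|y a IH]; first exact: tens1X.
by rewrite cat_cons -!wob_cons tensA IH.
Qed.

Definition wcons y a b (f : whom a b) : whom (y :: a) (y :: b) :=
  eqm (wob_cons y b) ∘ (idm y ⊠ f) ∘ eqm (esym (wob_cons y a)).

(* [ap l f r x] is the morphism x followed by f, whiskered by the word [rev l] on
   the left and by r on the right. Left contexts are kept reversed: then words
   such as [catrev (y :: l) s] and [catrev l (y :: s)] are convertible, and
   diagrammatic rules can be stated for variable l and r without casts. *)
Fixpoint wl l a b : whom a b -> whom (catrev l a) (catrev l b) :=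
  match l with
  | [::] => fun f => f
  | y :: l' => fun f => @wl l' (y :: a) (y :: b) (wcons y f)
  end.

Definition wr a b (f : whom a b) r : whom (a ++ r) (b ++ r) :=
  eqm (wob_cat b r) ∘ (f ⊠ idm (wob r)) ∘ eqm (esym (wob_cat a r)).

Definition ap T a b l (f : whom a b) r (x : hom T (wob (catrev l (a ++ r)))) :
  hom T (wob (catrev l (b ++ r))) := wl l (wr f r) ∘ x.

Arguments ap {T a b} l f r x.

(** As l is the left context reversed, its head is the strand nearest to the morphism and is
    tensored last, on the right. *)
Fixpoint lob l : C := if l is y :: l' then lob l' ⊗ y else 𝟙.

Lemma heq_wcons y a b (f : whom a b) : wcons y f ≈ idm y ⊠ f.
Proof. exact: heq_trans (heq_eqmr _ _) (heq_eqml _ _). Qed.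

Lemma heq_wr a b (f : whom a b) r : wr f r ≈ f ⊠ idm (wob r).
Proof. exact: heq_trans (heq_eqmr _ _) (heq_eqml _ _). Qed.

Lemma heq_wl l a b (f : whom a b) : wl l f ≈ idm (lob l) ⊠ f.
Proof.
elim: l a b f => [|y l IH] a b f; first exact/heq_sym/heq_tens1f.
apply: heq_trans (IH _ _ _) _.
apply: heq_trans (heq_tens (heq_refl _) (heq_wcons _ _)) _.
apply: heq_trans (heq_sym (heq_tensA _ _ _)) _; rewrite tensm1.
exact: heq_refl.
Qed.

Lemma lob_catrev b l : lob (catrev b l) = lob l ⊗ wob b.
Proof.
elim: b l => [|y b IH] l; first by rewrite /= tensX1.
by rewrite [LHS]IH /= tensA; congr (_ ⊗ _); apply: wob_cons.
Qed.

Lemma wob_catrev l a : wob (catrev l a) = lob l ⊗ wob a.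
Proof.
by elim: l a => [|y l IH] a; rewrite ?tens1X //= IH -wob_cons tensA.
Qed.

Lemma lob_cat m l : lob (m ++ l) = lob l ⊗ lob m.
Proof. by elim: m => [|y m IH] /=; rewrite ?tensX1 // IH tensA. Qed.

Definition cast T a b (e : a = b) (x : hom T (wob a)) : hom T (wob b) :=
  match e in _ = b return hom T (wob b) with erefl => x end.

Lemma heq_cast T a b (e : a = b) (x : hom T (wob a)) : cast e x ≈ x.
Proof. by case: b / e; apply: heq_refl. Qed.

Lemma wl_comp l a b c (g : whom b c) (f : whom a b) :
  wl l (g ∘ f : whom a c) = wl l g ∘ wl l f.
Proof.
elim: l a b c g f => [//|y l IH] a b c g f /=; rewrite -IH; congr wl.
rewrite /wcons tens1_comp -!compA; congr (_ ∘ (_ ∘ _)).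
by rewrite (compA (eqm _)) eqmK comp1m.
Qed.

Lemma wr_comp a b c (g : whom b c) (f : whom a b) r :
  wr (g ∘ f : whom a c) r = wr g r ∘ wr f r.
Proof.
rewrite /wr tens_comp1 -!compA; congr (_ ∘ (_ ∘ _)).
by rewrite (compA (eqm _)) eqmK comp1m.
Qed.

Lemma wl_id l a : wl l (idm (wob a) : whom a a) = idm (wob (catrev l a)).
Proof.
apply: heq_eq; apply: heq_trans (heq_wl _ _) _.
by rewrite tensm1 wob_catrev; apply: heq_refl.
Qed.

Lemma wr_id a r : wr (idm (wob a) : whom a a) r = idm (wob (a ++ r)).
Proof. by rewrite /wr tensm1 compm1 eqmK. Qed.

(* The casts vanish definitionally once [a] and [b] are explicit lists. *)
Lemma interchange T l a b s s' (f : whom a b) (h : whom s s')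
    (x : hom T (wob (catrev l (a ++ s)))) e1 e2 e3 e4 :
  cast e4 (wl (catrev b l) h ∘ cast e1 (wl l (wr f s) ∘ x)) =
  wl l (wr f s') ∘ cast e3 (wl (catrev a l) h ∘ cast e2 x).
Proof.
have L c : wl (catrev c l) h ≈ idm (lob l) ⊠ (idm (wob c) ⊠ h).
  apply: heq_trans (heq_wl _ _) _; rewrite lob_catrev -tensm1.
  exact: heq_tensA.
have R t : wl l (wr f t) ≈ idm (lob l) ⊠ (f ⊠ idm (wob t)).
  exact: heq_trans (heq_wl _ _) (heq_tens (heq_refl _) (heq_wr _ _)).
have E : wob (catrev l (a ++ s)) = lob l ⊗ (wob a ⊗ wob s).
  by rewrite wob_catrev -wob_cat.
have x' := heq_sym (heq_eqml E x).
apply: heq_eq; apply: heq_trans (heq_cast _ _) _.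
apply: heq_trans (heq_comp (L b) (heq_trans (heq_cast _ _)
  (heq_comp (R s) x'))) _.
apply: heq_sym; apply: heq_trans (heq_comp (R s') (heq_trans (heq_cast _ _)
  (heq_comp (L a) (heq_trans (heq_cast _ _) x')))) _.
apply: eq_heq; rewrite !compA; congr (_ ∘ _).
by rewrite -!tens1_comp tens_swap.
Qed.

Lemma ap_nested T l l' a b (f : whom a b) r' r
    (x : hom T (wob (catrev l (catrev l' (a ++ r') ++ r)))) e1 e2 :
  cast e2 (wl l (wr (wl l' (wr f r')) r) ∘ x) =
  ap (l' ++ l) f (r' ++ r) (cast e1 x).
Proof.
apply: heq_eq; apply: heq_trans (heq_cast _ _) _.
have E : wob (catrev l (catrev l' (a ++ r') ++ r)) =
    lob l ⊗ (lob l' ⊗ (wob a ⊗ wob r') ⊗ wob r).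
  by rewrite wob_catrev -wob_cat wob_catrev -wob_cat.
have E' : lob l ⊗ (lob l' ⊗ (wob a ⊗ wob r') ⊗ wob r) =
    lob l ⊗ lob l' ⊗ (wob a ⊗ (wob r' ⊗ wob r)) by rewrite !tensA.
have x' := heq_sym (heq_eqml E x).
apply: heq_trans (heq_comp (heq_trans (heq_wl _ _) (heq_tens (heq_refl _)
  (heq_trans (heq_wr _ _) (heq_tens (heq_trans (heq_wl _ _)
  (heq_tens (heq_refl _) (heq_wr _ _))) (heq_refl _))))) x') _.
apply: heq_sym; apply: heq_trans (heq_comp (heq_trans (heq_wl _ _)
  (heq_tens (heq_idm (lob_cat _ _)) (heq_trans (heq_wr _ _)
  (heq_tens (heq_refl _) (heq_idm (esym (wob_cat _ _)))))))
  (heq_trans (heq_cast _ _) (heq_trans x' (heq_sym (heq_eqml E' _))))) _.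
apply: heq_comp; last exact: heq_eqml.
rewrite -!tensm1; apply: heq_trans (heq_tensA _ _ _) _.
apply: heq_tens; first exact: heq_refl.
apply: heq_trans _ (heq_sym (heq_tensA _ _ _)).
apply: heq_tens; first exact: heq_refl.
exact/heq_sym/heq_tensA.
Qed.

(** Lets a morphism that is itself defined by a diagram be expanded in place inside a larger
    diagram. *)
Lemma ap_ap T l l' s a b (f : whom a b) r' r
    (y : whom s (catrev l' (a ++ r'))) (x : hom T (wob (catrev l (s ++ r))))
    e1 e2 :
  cast e2 (ap l (ap l' f r' y : whom s (catrev l' (b ++ r'))) r x) =
  ap (l' ++ l) f (r' ++ r) (cast e1 (ap l y r x)).
Proof.
by rewrite -(ap_nested _ _ _ e2) /ap wr_comp wl_comp -compA.
Qed.

Lemma ap_comp T l a b c (g : whom b c) (f : whom a b) r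
    (x : hom T (wob (catrev l (a ++ r)))) :
  ap l (g ∘ f : whom a c) r x = ap l g r (ap l f r x).
Proof. by rewrite /ap wr_comp wl_comp compA. Qed.

(** In empty contexts [ap] alters a morphism by identifications only, so equations of diagrams give
    back equations of morphisms. *)
Lemma ap_inj a b (f g : whom a b) :
  ap [::] f [::] (idm (wob (a ++ [::]))) =
  ap [::] g [::] (idm (wob (a ++ [::]))) -> f = g.
Proof.
move=> E; apply: heq_eq.
have ap_f (h : whom a b) : ap [::] h [::] (idm (wob (a ++ [::]))) ≈ h.
  rewrite /ap /= compm1; apply: heq_trans (heq_wr _ _) _.
  exact: heq_tensf1.
by apply: heq_trans (heq_sym (ap_f f)) _; rewrite E; apply: ap_f.
Qed.

Lemma ap_id T l a r (x : hom T (wob (catrev l (a ++ r)))) :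
  ap l (idm (wob a) : whom a a) r x = x.
Proof. by rewrite /ap wr_id wl_id comp1m. Qed.

End Words.

(** * Rewriting of string diagrams *)

Arguments ap {C T a b} l f r x.

(* Iterating it proves f ≈ g for composites, associated to the left, that differ
   by identifications only. *)
Ltac heq_step :=
  lazymatch goal with
  | |- heq (eqm ?e) (idm _) =>
    first [exact: (heq_eqm_cod e) | exact: (heq_eqm_dom e)]
  | |- heq (_ ∘ eqm _) _ => refine (heq_trans (heq_eqmr _ _) _)
  | |- heq (eqm _ ∘ _) _ => refine (heq_trans (heq_eqml _ _) _)
  | |- heq (_ ∘ idm _) _ => refine (heq_trans (eq_heq (compm1 _)) _)
  | |- heq _ (_ ∘ eqm _) => refine (heq_trans _ (heq_sym (heq_eqmr _ _)))
  | |- heq _ (eqm _ ∘ _) => refine (heq_trans _ (heq_sym (heq_eqml _ _)))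
  | |- heq _ (_ ∘ idm _) => refine (heq_trans _ (eq_heq (esym (compm1 _))))
  | |- heq (_ ∘ _) (_ ∘ _) => refine (heq_comp _ _)
  | |- heq (@wr ?C ?a ?b ?f ?r) _ => refine (heq_trans (@heq_wr C a b f r) _)
  | |- heq (@wcons ?C ?y ?a ?b ?f) _ =>
    refine (heq_trans (@heq_wcons C y a b f) _)
  | |- heq (_ ⊠ idm (wob [::])) _ => refine (heq_trans (heq_tensf1 _) _)
  | |- heq _ (_ ⊠ idm (wob [::]))  =>
    refine (heq_trans _ (heq_sym (heq_tensf1 _)))
  | |- heq (_ ⊠ idm 𝟙) _ => refine (heq_trans (heq_tensf1 _) _)
  | |- heq _ (@wr ?C ?a ?b ?f ?r) =>
    refine (heq_trans _ (heq_sym (@heq_wr C a b f r)))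
  | |- heq _ (@wcons ?C ?y ?a ?b ?f) =>
    refine (heq_trans _ (heq_sym (@heq_wcons C y a b f)))
  | |- heq _ (_ ⊠ idm 𝟙)  => refine (heq_trans _ (heq_sym (heq_tensf1 _)))
  | |- heq (_ ⊠ _ ⊠ _) _ => refine (heq_trans (heq_tensA _ _ _) _)
  | |- heq _ (_ ⊠ _ ⊠ _) =>
    refine (heq_trans _ (heq_sym (heq_tensA _ _ _)))
  | |- heq (_ ⊠ _) (_ ⊠ _) => refine (heq_tens _ _)
  | |- heq _ _ => exact: heq_refl
  end.

(** Compares the two sides of the goal with those of H, layer by layer and up to identifications. *)
Ltac heq_of H :=
  apply: heq_eq; refine (heq_trans _ (heq_trans (eq_heq H) _));
  rewrite /ap /= ?compA; repeat heq_step.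

(* Flattens [ap l (ap .. (ap .. id)) r x] into a composite of layers. *)
Ltac nested :=
  repeat match goal with
  | |- context [@ap ?C ?T ?s ?t ?l (@ap ?C _ ?a ?b ?l' ?f ?r' ?y) ?r ?x] =>
    rewrite (@ap_ap C T l l' s a b f r' r y x erefl erefl
      : @ap C T s t l (@ap C (wob s) a b l' f r' y) r x
        = ap (l' ++ l) f (r' ++ r) (@ap C T s (catrev l' (a ++ r')) l y r x));
    cbn [cat catrev]
  | |- context [@ap ?C ?T ?a ?a' ?l (idm _) ?r ?x] =>
    rewrite (@ap_id C T l a r x : @ap C T a a' l (idm _) r x = x)
  end.

(* Reduces a rule stated for all contexts l, r and all x to the case of empty
   contexts and x = id. *)
Ltac from_base :=
  lazymatch goal with |- ?G =>
    let t := constr:(fun H : G => H nil nil _ (idm _)) in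
    let ty := type of t in
    let ty := eval cbn [cat catrev] in ty in
    lazymatch ty with _ -> @eq (hom (@wob ?C ?a) (@wob _ ?b)) ?F ?G =>
      let base := fresh "base" in
      enough (base : @eq (hom (@wob C a) (@wob C b)) F G);
      [ let l := fresh "l" in let r := fresh "r" in let T := fresh "T" in
        let x := fresh "x" in intros l r T x;
        let E := fresh "E" in
        pose proof (congr1 (fun h => @ap C T a b l h r x) base) as E;
        cbn beta in E; move: E; nested; cbn [cat catrev];
        let F := fresh "E" in intro F; exact F | ]
    end end.

Ltac prefix l base :=
  match constr:((l, base)) with
  | (?l0, ?l0) => let T := type of l in
    lazymatch T with list ?T' => constr:(@nil T') end
  | (@cons ?T ?y ?l', _) => let p := prefix l' base in constr:(@cons T y p)
  end.

(** The case where g acts to the right of f: the left context of g is that of f, followed by the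
    output b of f and by the strands between them, which [prefix] recovers as m. *)
Ltac interchange_right f g :=
  match goal with
  | |- context [@ap ?C ?T ?c ?d ?l2 g ?r2 (@ap _ _ ?a ?b ?l1 f ?r1 ?x)] =>
    let l1' := eval cbn [catrev] in (catrev b l1) in
    let m := prefix l2 l1' in
    let l2' := eval cbn [cat catrev] in (m ++ catrev a l1) in
    let s' := eval cbn [cat catrev] in (catrev m (d ++ r2)) in
    rewrite (interchange (T := T) (l := l1) (s := r1) (s' := s') f
               (wl m (wr g r2)) x erefl erefl erefl erefl
             : @ap C T c d l2 g r2 (@ap C T a b l1 f r1 x) =
               @ap C T a b l1 f s' (@ap C T c d l2' g r2 x))
  end.

Ltac interchange_left f g :=
  match goal with
  | |- context [@ap ?C ?T ?c ?d ?l2 g ?r2 (@ap _ _ ?a ?b ?l1 f ?r1 ?x)] =>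
    let l2' := eval cbn [catrev] in (catrev c l2) in
    let m := prefix l1 l2' in
    let l1' := eval cbn [cat catrev] in (m ++ catrev d l2) in
    let s := eval cbn [cat catrev] in (catrev m (a ++ r1)) in
    let s' := eval cbn [cat catrev] in (catrev m (b ++ r1)) in
    rewrite -(interchange (T := T) (l := l2) (s := s) (s' := s') g
               (wl m (wr f r1)) x erefl erefl erefl erefl
             : @ap C T a b l1' f r1 (@ap C T c d l2 g s x) =
               @ap C T c d l2 g r2 (@ap C T a b l1 f r1 x))
  end.

(* [xch g f] swaps two adjacent layers on disjoint strands, g being applied after
   f. *)
Tactic Notation "xch" constr(g) constr(f) :=
  first [interchange_right f g | interchange_left f g].

(** * Frobenius algebras and Nakayama automorphisms *)

Section Algebra.
Variables (C : strict_monoidal_category) (Aalg : algebra C).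
Local Notation A := (alg_ob Aalg).

Definition wmul : whom [:: A; A] [:: A] := mul Aalg.
Definition weta : whom [::] [:: A] := eta Aalg.

(** Like all later rules, this is stated in every context and after every x, so that it rewrites
    anywhere inside a diagram. *)
Lemma wmulA l r T (x : hom T _) :
  ap l wmul r (ap l wmul (A :: r) x) = ap l wmul r (ap (A :: l) wmul r x).
Proof. by move: l r T x; from_base; heq_of (mulA Aalg). Qed.

Lemma wmul1m l r T (x : hom T _) :
  ap l wmul r (ap l weta (A :: r) x) = x.
Proof. by move: l r T x; from_base; heq_of (mul1m Aalg). Qed.

Lemma wmulm1 l r T (x : hom T _) :
  ap l wmul r (ap (A :: l) weta r x) = x.
Proof. by move: l r T x; from_base; heq_of (mulm1 Aalg). Qed.

Variable p : frobenius_pair Aalg.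

Definition wform : whom [:: A] [::] := fform p.
Definition wfelt : whom [::] [:: A; A] := felt p.

Lemma wfelt_casimir l r T (x : hom T _) :
  ap l wmul (A :: r) (ap (A :: l) wfelt r x) =
  ap (A :: l) wmul r (ap l wfelt (A :: r) x).
Proof. by move: l r T x; from_base; heq_of (felt_casimir p). Qed.

Lemma wform_feltl l r T (x : hom T _) :
  ap l wform (A :: r) (ap l wfelt r x) = ap l weta r x.
Proof. by move: l r T x; from_base; heq_of (fform_feltl p). Qed.

Lemma wform_feltr l r T (x : hom T _) :
  ap (A :: l) wform r (ap l wfelt r x) = ap l weta r x.
Proof. by move: l r T x; from_base; heq_of (fform_feltr p). Qed.

(** With [felt_snaker], this makes ϑ m and e a duality of A with itself: the Casimir identity moves
    the product to the other leg of e, where ϑ cancels against e. *)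
Lemma felt_snakel l r T (x : hom T _) :
  ap l wform (A :: r) (ap l wmul (A :: r) (ap (A :: l) wfelt r x)) = x.
Proof.
by rewrite wfelt_casimir; xch wform wmul; rewrite wform_feltl wmul1m.
Qed.

Lemma felt_snaker l r T (x : hom T _) :
  ap (A :: l) wform r (ap (A :: l) wmul r (ap l wfelt (A :: r) x)) = x.
Proof.
by rewrite -wfelt_casimir; xch wform wmul; rewrite wform_feltr wmulm1.
Qed.

End Algebra.

Lemma frobenius_pair_exists (C : strict_monoidal_category) (Aalg : algebra C)
    (A := alg_ob Aalg) (t : whom [:: A] [::]) (e : whom [::] [:: A; A]) :
  ap [::] (wmul Aalg) [:: A] (ap [:: A] e [::] (idm (wob [:: A]))) =
  ap [:: A] (wmul Aalg) [::] (ap [::] e [:: A] (idm (wob [:: A]))) ->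
  ap [::] t [:: A] (ap [::] e [::] (idm (wob [::]))) =
  ap [::] (weta Aalg) [::] (idm (wob [::])) ->
  ap [:: A] t [::] (ap [::] e [::] (idm (wob [::]))) =
  ap [::] (weta Aalg) [::] (idm (wob [::])) ->
  exists p : frobenius_pair Aalg, wform p = t /\ wfelt p = e.
Proof.
move=> cas tl tr; unshelve eexists; first exists t e.
- by heq_of cas.
- by heq_of tl.
- by heq_of tr.
by [].
Qed.

(** * Duals and transposes in a sovereign category *)

Section Duality.
Variables (C : strict_monoidal_category) (sv : sovereign C).

Definition wev (X : C) : whom [:: hat sv X; X] [::] := ev (hat_left sv X).
Definition wcoev (X : C) : whom [::] [:: X; hat sv X] :=
  coev (hat_left sv X).
Definition wevr (X : C) : whom [:: X; hat sv X] [::] := evr (hat_right sv X).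
Definition wcoevr (X : C) : whom [::] [:: hat sv X; X] :=
  coevr (hat_right sv X).

Lemma wev_coevX (X : C) l r T (x : hom T _) :
  ap (X :: l) (wev X) r (ap l (wcoev X) (X :: r) x) = x.
Proof. by move: l r T x; from_base; heq_of (ev_coevX (hat_left sv X)). Qed.

Lemma wevr_coevrX (X : C) l r T (x : hom T _) :
  ap l (wevr X) (X :: r) (ap (X :: l) (wcoevr X) r x) = x.
Proof. by move: l r T x; from_base; heq_of (evr_coevrX (hat_right sv X)). Qed.

Lemma wevr_coevrD (X : C) l r T (x : hom T _) :
  ap (hat sv X :: l) (wevr X) r (ap l (wcoevr X) (hat sv X :: r) x) = x.
Proof. by move: l r T x; from_base; heq_of (evr_coevrD (hat_right sv X)). Qed.

Variables (X Y : C) (f : whom [:: X] [:: Y]).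

Definition wtranspose : whom [:: hat sv Y] [:: hat sv X] :=
  right_transpose (hat_right sv X) (hat_right sv Y) f.

Lemma wtransposeE l r T (x : hom T _) :
  ap l wtranspose r x =
  ap (hat sv X :: l) (wevr Y) r (ap (hat sv X :: l) f (hat sv Y :: r)
    (ap l (wcoevr X) (hat sv Y :: r) x)).
Proof.
move: l r T x; from_base.
heq_of (erefl (right_transpose (hat_right sv X) (hat_right sv Y) f)).
by rewrite /right_transpose ?compA; repeat heq_step.
Qed.

(** Sovereignty enters here: the right transpose is also computed by the left duality. *)
Lemma wtransposeE' l r T (x : hom T _) :
  ap l wtranspose r x =
  ap l (wev Y) (hat sv X :: r) (ap (hat sv Y :: l) f (hat sv X :: r)
    (ap (hat sv Y :: l) (wcoev X) r x)).
Proof.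
move: l r T x; from_base.
heq_of (esym (hat_morE sv f)).
by rewrite /left_transpose ?compA; repeat heq_step.
Qed.

(** By the left formula, the zigzag of [wev] and [wcoev] on X straightens. The next lemma uses the
    right formula, so one morphism slides along both [wev] and [wcoevr], the two dualities mixed in
    the Nakayama automorphism. *)
Lemma wev_transpose l r T (x : hom T _) :
  ap l (wev X) r (ap l wtranspose (X :: r) x) =
  ap l (wev Y) r (ap (hat sv Y :: l) f r x).
Proof.
rewrite wtransposeE'; xch (wev X) (wev Y); xch (wev X) f.
by rewrite wev_coevX.
Qed.

Lemma wcoevr_transpose l r T (x : hom T _) :
  ap (hat sv X :: l) f r (ap l (wcoevr X) r x) =
  ap l wtranspose (Y :: r) (ap l (wcoevr Y) r x).
Proof.
rewrite wtransposeE; xch (wcoevr X) (wcoevr Y).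
xch f (wcoevr Y).
by rewrite wevr_coevrX.
Qed.

End Duality.

(** * Nakayama automorphisms of two algebras related by a form *)

Section Nakayama.
Variables (C : strict_monoidal_category) (sv : sovereign C).

Section OneAlgebra.
Variables (Aalg : algebra C) (p : frobenius_pair Aalg).
Local Notation A := (alg_ob Aalg).
Local Notation D := (hat sv A).
Local Notation m := (wmul Aalg).

Definition wnak : whom [:: A] [:: A] := nakayama sv p.

Lemma wnakE l r T (x : hom T _) :
  ap l wnak r x =
  ap l (wev sv A) (A :: r) (ap (D :: l) (wfelt p) r (ap (D :: l) (wform p) r
    (ap (D :: l) m r (ap l (wcoevr sv A) (A :: r) x)))).
Proof.
move: l r T x; from_base; heq_of (erefl (nakayama sv p)).
by rewrite /nakayama (tens1_comp _ (fform p)) ?compA; repeat heq_step.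
Qed.

(** This is ϑ(N(x) y) = ϑ(y x) without a symmetry: [wcoevr] and [wev] carry y round to the left of
    x. *)
Lemma wnak_form l r T (x : hom T _) :
  ap l (wform p) r (ap l m r (ap l wnak (A :: r) x)) =
  ap l (wev sv A) r (ap (D :: l) (wform p) (A :: r) (ap (D :: l) m (A :: r)
    (ap l (wcoevr sv A) (A :: A :: r) x))).
Proof.
rewrite wnakE; xch m (wev sv A); xch (wform p) (wev sv A).
by rewrite felt_snaker.
Qed.

(* Right invertibility of the Nakayama automorphism. *)
Lemma wnakK l r T (x : hom T _) :
  ap l wnak r (ap (A :: l) (wevr sv A) r (ap l (wfelt p) (D :: r)
    (ap l (wform p) (D :: r) (ap l m (D :: r)
      (ap (A :: l) (wcoev sv A) r x))))) = x.
Proof.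
rewrite wnakE; xch (wcoevr sv A) (wevr sv A); xch (wcoevr sv A) (wfelt p).
xch m (wevr sv A); xch (wform p) (wevr sv A); rewrite felt_snakel.
rewrite wevr_coevrD.
xch (wfelt p) (wform p); xch (wev sv A) (wform p).
xch (wfelt p) m; xch (wev sv A) m.
xch (wfelt p) (wcoev sv A); rewrite wev_coevX.
by rewrite felt_snakel.
Qed.

End OneAlgebra.

Variables (Ralg Salg : algebra C) (pR : frobenius_pair Ralg)
  (pS : frobenius_pair Salg).
Local Notation R := (alg_ob Ralg).
Local Notation S := (alg_ob Salg).
Variables (i : whom [:: R] [:: S]) (th : whom [:: S] [:: R]).

(** Both directions of the theorem supply this: it holds for the composite form ϑ_R ϑ' and for
    [rel_form]. *)
Hypothesis formE : forall l r T (x : hom T _),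
  ap l (wform pS) r (ap l (wmul Salg) r (ap (S :: l) i r x)) =
  ap l (wform pR) r (ap l (wmul Ralg) r (ap l th (R :: r) x)).

Lemma coevr_form l r T (x : hom T _) :
  ap (hat sv S :: l) (wform pS) r (ap (hat sv S :: l) (wmul Salg) r
    (ap l (wcoevr sv S) (S :: r) (ap l i r x))) =
  ap l (wtranspose sv th) r (ap (hat sv R :: l) (wform pR) r
    (ap (hat sv R :: l) (wmul Ralg) r (ap l (wcoevr sv R) (R :: r) x))).
Proof.
xch (wcoevr sv S) i; rewrite formE wcoevr_transpose.
by xch (wmul Ralg) (wtranspose sv th); xch (wform pR) (wtranspose sv th).
Qed.

(** By [coevr_form], ϑ' appears transposed on the dual strand; it slides through [wev] onto the
    first leg of e_S, where the hypothesis trades it for i on the second leg of e_R. *)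
Lemma nakayama_commute :
  (forall l r T (x : hom T _),
    ap l th (S :: r) (ap l (wfelt pS) r x) =
    ap (R :: l) i r (ap l (wfelt pR) r x)) ->
  forall l r T (x : hom T _),
    ap l (wnak pS) r (ap l i r x) = ap l i r (ap l (wnak pR) r x).
Proof.
move=> feltE l r T x; rewrite !wnakE coevr_form.
xch (wfelt pS) (wtranspose sv th); rewrite wev_transpose feltE.
by xch (wev sv R) i.
Qed.

Lemma nakayama_form :
  (forall l r T (x : hom T _),
    ap l (wnak pS) r (ap l i r x) = ap l i r (ap l (wnak pR) r x)) ->
  forall l r T (x : hom T _),
    ap l (wform pS) r (ap l (wmul Salg) r (ap l i (S :: r) x)) =
    ap l (wform pR) r (ap l (wmul Ralg) r (ap (R :: l) th r x)).
Proof.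
(* Writing r = N_R(r') gives ϑ_S(i(r) s) = ϑ_S(N_S(i(r')) s) = ϑ_S(s i(r')) = ϑ_R(ϑ'(s) r') = ϑ_R(r
   ϑ'(s)), up to carrying strands round. *)
move=> nakE l r T x; rewrite -[x](wnakK pR) -nakE wnak_form coevr_form.
rewrite wev_transpose; xch th (wform pR); xch th (wmul Ralg).
by xch th (wcoevr sv R); rewrite -wnak_form; xch th (wnak pR).
Qed.

End Nakayama.

(** * Separability elements of Frobenius algebras *)

Section Separable.
Variables (C : strict_monoidal_category) (Aalg : algebra C)
  (p : frobenius_pair Aalg).
Local Notation A := (alg_ob Aalg).
Local Notation m := (wmul Aalg).
Local Notation u := (weta Aalg).
Local Notation t := (wform p).
Local Notation e := (wfelt p).

Variable g : whom [:: A] [:: A; A].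
Hypothesis gl : left_linear (Y := left_regular Aalg)
  (Y' := left_tensor (left_regular Aalg) A) g.
Hypothesis gr : right_linear (X := right_regular Aalg)
  (X' := right_tensor A (right_regular Aalg)) g.
Hypothesis mg : mul Aalg ∘ g = idm A.

Lemma split_linl l r T (x : hom T _) :
  ap l g r (ap l m r x) = ap l m (A :: r) (ap (A :: l) g r x).
Proof. by move: l r T x; from_base; heq_of gl. Qed.

Lemma split_linr l r T (x : hom T _) :
  ap l g r (ap l m r x) = ap (A :: l) m r (ap l g (A :: r) x).
Proof. by move: l r T x; from_base; heq_of gr. Qed.

Lemma split_mul l r T (x : hom T _) : ap l m r (ap l g r x) = x.
Proof. by move: l r T x; from_base; heq_of mg. Qed.

(** Both sides equal g, by left and right linearity. *)
Lemma split_casimir l r T (x : hom T _) :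
  ap l m (A :: r) (ap (A :: l) g r (ap (A :: l) u r x)) =
  ap (A :: l) m r (ap l g (A :: r) (ap l u (A :: r) x)).
Proof. by rewrite -split_linl -split_linr wmulm1 wmul1m. Qed.

(* If g ∘ u = Σ f1 ⊗ f2 is the separability element, this is Σ ϑ(f1) f2. *)
Definition sep_elt : whom [::] [:: A] :=
  ap [::] t [:: A] (ap [::] g [::] (ap [::] u [::] (idm (wob [::])))).

Lemma sep_eltE l r T (x : hom T _) :
  ap l sep_elt r x = ap l t (A :: r) (ap l g r (ap l u r x)).
Proof. by rewrite /sep_elt; nested. Qed.

(** For e = Σ a ⊗ b and g(1) = Σ f1 ⊗ f2: Σ a ⊗ ϑ(f1) f2 b = Σ a ϑ(b f1) ⊗ f2 = Σ f1 ⊗ f2. *)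
Lemma felt_sep_elt l r T (x : hom T _) :
  ap (A :: l) m r (ap (A :: l) sep_elt (A :: r) (ap l e r x)) =
  ap l g r (ap l u r x).
Proof.
rewrite sep_eltE; xch m t; rewrite -split_casimir.
xch u e; xch g e.
by rewrite felt_snaker.
Qed.

Lemma felt_mul_sep_elt l r T (x : hom T _) :
  ap l m r (ap (A :: l) m r (ap (A :: l) sep_elt (A :: r) (ap l e r x))) =
  ap l u r x.
Proof. by rewrite felt_sep_elt split_mul. Qed.

(** The counterpart of [felt_mul_sep_elt] for Σ f1 ϑ(f2): here Σ a f1 ϑ(f2) b = Σ f1 ϑ(f2 a) b = Σ
    f1 f2. *)
Lemma felt_mul_split_form l r T (x : hom T _) :
  ap l m r (ap l m (A :: r) (ap (A :: A :: l) t (A :: r)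
    (ap (A :: l) g (A :: r) (ap (A :: l) u (A :: r) (ap l e r x))))) =
  ap l u r x.
Proof.
xch m t; rewrite split_casimir; xch u e; xch g e.
by rewrite felt_snakel split_mul.
Qed.

End Separable.

(** * Algebra extensions *)

Section Extension.
Variables (C : strict_monoidal_category) (sv : sovereign C).
Variables (Ralg Salg : algebra C) (ia : algebra_morphism Ralg Salg).
Local Notation R := (alg_ob Ralg).
Local Notation S := (alg_ob Salg).
Local Notation mR := (wmul Ralg).
Local Notation mS := (wmul Salg).
Local Notation uR := (weta Ralg).
Local Notation uS := (weta Salg).

Definition wext : whom [:: R] [:: S] := alg_hom ia.
Local Notation i := wext.

Lemma wextM l r T (x : hom T _) :
  ap l i r (ap l mR r x) = ap l mS r (ap l i (S :: r) (ap (R :: l) i r x)).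
Proof.
move: l r T x; from_base.
have H : ia ∘ mul Ralg = mul Salg ∘ (ia ⊠ idm S) ∘ (idm R ⊠ ia).
  by rewrite alg_homM -compA -tensm_comp compm1 comp1m.
by heq_of H.
Qed.

Lemma wext1 l r T (x : hom T _) : ap l i r (ap l uR r x) = ap l uS r x.
Proof. by move: l r T x; from_base; heq_of (alg_hom1 ia). Qed.

(** * Relative form and Casimir element from Frobenius pairs of R and S *)

Section Frobenius_pairs.
Variables (pR : frobenius_pair Ralg) (pS : frobenius_pair Salg).
Local Notation tR := (wform pR).
Local Notation tS := (wform pS).
Local Notation eR := (wfelt pR).
Local Notation eS := (wfelt pS).

(* x ↦ Σ ϑ_S(x a) b, for e_R = Σ a ⊗ b. *)
Definition rel_form : whom [:: S] [:: R] :=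
  ap [::] tS [:: R] (ap [::] mS [:: R] (ap [:: S] i [:: R]
    (ap [:: S] eR [::] (idm (wob [:: S]))))).
Local Notation th := rel_form.

Lemma rel_formE l r T (x : hom T _) :
  ap l th r x = ap l tS (R :: r) (ap l mS (R :: r) (ap (S :: l) i (R :: r)
    (ap (S :: l) eR r x))).
Proof. by rewrite /rel_form; nested. Qed.

Lemma rel_form_form l r T (x : hom T _) :
  ap l tS r (ap l mS r (ap (S :: l) i r x)) =
  ap l tR r (ap l mR r (ap l th (R :: r) x)).
Proof.
rewrite rel_formE; xch mR tS; xch tR tS; xch mR mS; xch tR mS; xch mR i.
by xch tR i; rewrite felt_snaker.
Qed.

Lemma rel_form_linr l r T (x : hom T _) :
  ap l th r (ap l mS r (ap (S :: l) i r x)) = ap l mR r (ap l th (R :: r) x).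
Proof.
rewrite !rel_formE; xch mR tS; xch mR mS; xch mR i; xch eR mS.
xch i mS; rewrite wmulA; xch eR i; xch i i; rewrite -wextM.
by rewrite wfelt_casimir.
Qed.

Hypothesis nakE : nakayama sv pS ∘ ia = ia ∘ nakayama sv pR.

Lemma rel_form_forml l r T (x : hom T _) :
  ap l tS r (ap l mS r (ap l i (S :: r) x)) =
  ap l tR r (ap l mR r (ap (R :: l) th r x)).
Proof.
move: l r T x; apply: (nakayama_form (sv := sv) rel_form_form).
move=> l r T x; have E : (wnak sv pS ∘ i : whom [:: R] [:: S]) =
  i ∘ wnak sv pR := nakE.
by rewrite -!ap_comp E.
Qed.

(** ϑ'(r x) = Σ ϑ_S(r x a) b = Σ ϑ_R(r ϑ'(x a)) b = Σ ϑ_R(r ϑ'(x) a) b = r ϑ'(x), using right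
    linearity. *)
Lemma rel_form_linl l r T (x : hom T _) :
  ap l th r (ap l mS r (ap l i (S :: r) x)) = ap l mR r (ap (R :: l) th r x).
Proof.
rewrite [LHS]rel_formE; xch eR mS; xch eR i; xch i mS; rewrite wmulA.
xch i i; xch mS i; rewrite rel_form_forml.
rewrite rel_form_linr -wmulA; xch th eR; xch mR eR.
by rewrite felt_snakel.
Qed.

Lemma rel_formE' l r T (x : hom T _) :
  ap l th r x = ap (R :: l) tS r (ap (R :: l) mS r (ap (R :: l) i (S :: r)
    (ap l eR (S :: r) x))).
Proof. by rewrite rel_form_forml; xch th eR; rewrite felt_snaker. Qed.

Lemma rel_form_felt l r T (x : hom T _) :
  ap (S :: l) th r (ap l eS r x) = ap l i (R :: r) (ap l eR r x).
Proof.
rewrite rel_formE; xch eR eS; xch i eS; rewrite felt_snaker.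
by [].
Qed.

Variable g : whom [:: R] [:: R; R].
Hypothesis gl : left_linear (Y := left_regular Ralg)
  (Y' := left_tensor (left_regular Ralg) R) g.
Hypothesis gr : right_linear (X := right_regular Ralg)
  (X' := right_tensor R (right_regular Ralg)) g.
Hypothesis mg : mul Ralg ∘ g = idm R.

Local Notation w := (sep_elt pR g).

(** A lift of e' to S ⊗ S. As w sits between the legs of e_S, the Casimir identity already holds
    before passing to the quotient. *)
Definition rel_felt : whom [::] [:: S; S] :=
  ap [:: S] mS [::] (ap [:: S] i [:: S] (ap [:: S] w [:: S]
    (ap [::] eS [::] (idm (wob [::]))))).
Local Notation b := rel_felt.

Lemma rel_feltE l r T (x : hom T _) :
  ap l b r x =
  ap (S :: l) mS r (ap (S :: l) i (S :: r) (ap (S :: l) w (S :: r)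
    (ap l eS r x))).
Proof. by rewrite /rel_felt; nested. Qed.

Lemma rel_felt_casimir l r T (x : hom T _) :
  ap l mS (S :: r) (ap (S :: l) b r x) = ap (S :: l) mS r (ap l b (S :: r) x).
Proof.
rewrite !rel_feltE; xch mS mS; xch mS i; xch mS w.
rewrite wfelt_casimir; xch w mS; xch i mS.
by rewrite wmulA.
Qed.

(** With ϑ'(x) = Σ a ϑ_S(b x), the Casimir identity moves b to the second leg; ϑ_S then cancels e_S
    and leaves Σ a w b = 1. *)
Lemma rel_felt_forml l r T (x : hom T _) :
  ap l mS r (ap l i (S :: r) (ap l th (S :: r) (ap l b r x))) = ap l uS r x.
Proof.
rewrite rel_formE'; xch eR b; xch i b; rewrite rel_felt_casimir rel_feltE.
xch tS mS; xch tS mS; xch tS i; xch tS w; rewrite wform_feltl.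
xch w uS; xch i uS; rewrite wmulm1; xch w i.
by rewrite -!wextM felt_mul_sep_elt // wext1.
Qed.

Lemma rel_felt_form_snd l r T (x : hom T _) :
  ap (S :: l) tS r (ap l b r x) =
  ap l i r (ap (R :: l) tR r (ap l g r (ap l uR r x))).
Proof.
rewrite rel_feltE rel_form_forml; xch th w; rewrite rel_form_felt.
xch w i; xch mR i; xch tR i.
by rewrite felt_sep_elt.
Qed.

(** With ϑ'(x) = Σ ϑ_S(x a) b, the Casimir identity moves a to the first leg, and
    [rel_felt_form_snd] leaves Σ a f1 ϑ_R(f2) b = 1. *)
Lemma rel_felt_formr l r T (x : hom T _) :
  ap l mS r (ap (S :: l) i r (ap (S :: l) th r (ap l b r x))) = ap l uS r x.
Proof.
rewrite rel_formE; xch eR b; xch i b; rewrite -rel_felt_casimir.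
xch tS mS; rewrite rel_felt_form_snd.
xch uR i; xch g i; xch tR i; xch i i; rewrite -wextM.
by xch i i; rewrite -wextM felt_mul_split_form // wext1.
Qed.

End Frobenius_pairs.

(** * The relative tensor product of S with itself over R *)

Section Relative_tensor.
Variables (cq : coequalizers C) (cofl : forall X : C, coflat X).

Local Notation lS := (left_restriction ia (left_regular Salg)).
Local Notation rS := (right_restriction ia (right_regular Salg)).
Local Notation SS := (tensR cq rS lS).
Local Notation lact := (ext_lact cq cofl ia).
Local Notation ract := (ext_ract cq cofl ia).

Definition wquot : whom [:: S; S] [:: SS] := tensRq cq rS lS.
Definition wlact : whom [:: S; SS] [:: SS] := lact.
Definition wract : whom [:: SS; S] [:: SS] := ract.
Local Notation q := wquot.

Lemma wlactE l r T (x : hom T _) :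
  ap l wlact r (ap (S :: l) q r x) = ap l q r (ap l mS (S :: r) x).
Proof.
move: l r T x; from_base.
by heq_of (descE (proj1 (cofl S (tensRqP cq rS lS))) (ext_lact_subproof cq ia)).
Qed.

Lemma wractE l r T (x : hom T _) :
  ap l wract r (ap l q (S :: r) x) = ap l q r (ap (S :: l) mS r x).
Proof.
move: l r T x; from_base.
by heq_of (descE (proj2 (cofl S (tensRqP cq rS lS))) (ext_ract_subproof cq ia)).
Qed.

Lemma wquot_epi a (F G : whom [:: SS] a) :
  ap [::] F [::] (ap [::] q [::] (idm (wob [:: S; S]))) =
  ap [::] G [::] (ap [::] q [::] (idm (wob [:: S; S]))) -> F = G.
Proof.
by move=> E; apply: (coeq_epi (tensRqP cq rS lS)); heq_of E.
Qed.

(** Coflatness keeps S ⊗ q a coequalizer map, hence epi. *)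
Lemma wquot_epil a (F G : whom [:: S; SS] a) :
  ap [::] F [::] (ap [:: S] q [::] (idm (wob [:: S; S; S]))) =
  ap [::] G [::] (ap [:: S] q [::] (idm (wob [:: S; S; S]))) -> F = G.
Proof.
move=> E; apply: (coeq_epi (proj1 (cofl S (tensRqP cq rS lS)))).
by heq_of E.
Qed.

Lemma wquot_epir a (F G : whom [:: SS; S] a) :
  ap [::] F [::] (ap [::] q [:: S] (idm (wob [:: S; S; S]))) =
  ap [::] G [::] (ap [::] q [:: S] (idm (wob [:: S; S; S]))) -> F = G.
Proof.
move=> E; apply: (coeq_epi (proj2 (cofl S (tensRqP cq rS lS)))).
by heq_of E.
Qed.

Section Relative_form.
Variable th : whom [:: S] [:: R].
Hypothesis thl : left_linear (Y := lS) (Y' := left_regular Ralg) th.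
Hypothesis thr : right_linear (X := rS) (X' := right_regular Ralg) th.

(* x ⊗_R y ↦ x ϑ'(y) and x ⊗_R y ↦ ϑ'(x) y. *)
Definition contrr : whom [:: SS] [:: S] :=
  upsilon cq rS ∘ tensR_mapr cq rS thl.
Definition contrl : whom [:: SS] [:: S] :=
  upsilon' cq lS ∘ tensR_mapl cq lS thr.

Lemma contrrE l r T (x : hom T _) :
  ap l contrr r (ap l q r x) =
  ap l mS r (ap (S :: l) i r (ap (S :: l) th r x)).
Proof.
move: l r T x; from_base.
have H : contrr ∘ tensRq cq rS lS = mul Salg ∘ (idm S ⊠ ia) ∘ (idm S ⊠ th).
  rewrite /contrr -[LHS]compA.
  have -> : tensR_mapr cq rS thl ∘ tensRq cq rS lS =
    tensRq cq rS (left_regular Ralg) ∘ (idm S ⊠ th) := descE _ _.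
  have E : upsilon cq rS ∘ tensRq cq rS (left_regular Ralg) = Defs.ract rS :=
    descE _ _.
  by rewrite [LHS]compA E.
(* Generalized, since [compA] in [heq_of] would unfold [contrr]. *)
move: contrr H => k H; by heq_of H.
Qed.

Lemma contrlE l r T (x : hom T _) :
  ap l contrl r (ap l q r x) =
  ap l mS r (ap l i (S :: r) (ap l th (S :: r) x)).
Proof.
move: l r T x; from_base.
have H : contrl ∘ tensRq cq rS lS = mul Salg ∘ (ia ⊠ idm S) ∘ (th ⊠ idm S).
  rewrite /contrl -[LHS]compA.
  have -> : tensR_mapl cq lS thr ∘ tensRq cq rS lS =
    tensRq cq (right_regular Ralg) lS ∘ (th ⊠ idm S) := descE _ _.
  have E : upsilon' cq lS ∘ tensRq cq (right_regular Ralg) lS = Defs.lact lS :=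
    descE _ _.
  by rewrite [LHS]compA E.
move: contrl H => k H; by heq_of H.
Qed.

(** Transports the counit condition into S along the isomorphism Υ. *)
Lemma contrr_elt (e : whom [::] [:: SS]) :
  tensR_mapr cq rS thl ∘ e = upsilon_inv cq rS ∘ eta Salg <->
  contrr ∘ e = eta Salg.
Proof.
have -> : contrr ∘ e = upsilon cq rS ∘ (tensR_mapr cq rS thl ∘ e).
  exact/esym/compA.
split=> [->|<-]; first by rewrite compA upsilon_invK comp1m.
by rewrite [RHS]compA upsilonK comp1m.
Qed.

Lemma contrl_elt (e : whom [::] [:: SS]) :
  tensR_mapl cq lS thr ∘ e = upsilon'_inv cq lS ∘ eta Salg <->
  contrl ∘ e = eta Salg.
Proof.
have -> : contrl ∘ e = upsilon' cq lS ∘ (tensR_mapl cq lS thr ∘ e).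
  exact/esym/compA.
split=> [->|<-]; first by rewrite compA upsilon'_invK comp1m.
by rewrite [RHS]compA upsilon'K comp1m.
Qed.

Lemma wlinl l r T (x : hom T _) :
  ap l th r (ap l mS r (ap l i (S :: r) x)) = ap l mR r (ap (R :: l) th r x).
Proof.
move: l r T x; from_base; have H := thl.
by rewrite /left_linear /= compA in H; heq_of H.
Qed.

Lemma wlinr l r T (x : hom T _) :
  ap l th r (ap l mS r (ap (S :: l) i r x)) = ap l mR r (ap l th (R :: r) x).
Proof.
move: l r T x; from_base; have H := thr.
by rewrite /right_linear /= compA in H; heq_of H.
Qed.

(** * From a Frobenius extension to a Frobenius pair of S *)

Section To_frobenius.
Variable pR : frobenius_pair Ralg.
Local Notation tR := (wform pR).
Local Notation eR := (wfelt pR).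

(* x ⊗ y ↦ Σ x a ⊗ b y, for e_R = Σ a ⊗ b. *)
Definition spread_quot : whom [:: S; S] [:: S; S] :=
  ap [:: S] mS [::] (ap [::] mS [:: S; S] (ap [:: S] i [:: S; S]
    (ap [:: R; S] i [:: S] (ap [:: S] eR [:: S] (idm (wob [:: S; S])))))).

Lemma spread_quotE l r T (x : hom T _) :
  ap l spread_quot r x =
  ap (S :: l) mS r (ap l mS (S :: S :: r) (ap (S :: l) i (S :: S :: r)
    (ap (R :: S :: l) i (S :: r) (ap (S :: l) eR (S :: r) x)))).
Proof. by rewrite /spread_quot; nested. Qed.

(** Σ x r a ⊗ b y = Σ x a ⊗ b r y by the Casimir identity of e_R. *)
Lemma spread_quot_subproof :
  spread_quot ∘ tensR_l rS lS = spread_quot ∘ tensR_r rS lS.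
Proof.
have H : ap [::] spread_quot [::] (ap [::] mS [:: S] (ap [:: S] i [:: S]
    (idm (wob [:: S; R; S])))) =
  ap [::] spread_quot [::] (ap [:: S] mS [::] (ap [:: S] i [:: S]
    (idm (wob [:: S; R; S])))).
  rewrite !spread_quotE.
  xch eR mS; xch i mS; xch i mS; rewrite wmulA.
  xch eR i; xch i i; xch i i; rewrite -wextM.
  xch mR i; rewrite wfelt_casimir wextM.
  xch eR mS; xch eR i; xch i mS; xch i mS; xch i mS.
  by xch mS mS; rewrite wmulA; xch mS mS.
rewrite /tensR_l /tensR_r /= tens_comp1 tens1_comp.
move: spread_quot H => k H.
by heq_of H.
Qed.

Definition spread : whom [:: SS] [:: S; S] :=
  desc (tensRqP cq rS lS) spread_quot_subproof.

Lemma spreadE l r T (x : hom T _) :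
  ap l spread r (ap l q r x) = ap l spread_quot r x.
Proof.
move: l r T x; from_base.
have H := descE (tensRqP cq rS lS) spread_quot_subproof.
rewrite -/spread in H; move: spread spread_quot H => k k' H.
by heq_of H.
Qed.

(** With [spread_ract], this carries the Casimir identity of e' over to its image in S ⊗ S. *)
Lemma spread_lact l r T (x : hom T _) :
  ap l spread r (ap l wlact r x) = ap l mS (S :: r) (ap (S :: l) spread r x).
Proof.
move: l r T x; from_base; apply: wquot_epil; nested.
rewrite wlactE !spreadE !spread_quotE.
by xch eR mS; xch i mS; xch i mS; rewrite wmulA; xch mS mS.
Qed.

Lemma spread_ract l r T (x : hom T _) :
  ap l spread r (ap l wract r x) = ap (S :: l) mS r (ap l spread (S :: r) x).
Proof.
move: l r T x; from_base; apply: wquot_epir; nested.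
rewrite wractE !spreadE !spread_quotE wmulA.
xch eR mS; xch i mS; xch i mS.
by symmetry; xch mS mS.
Qed.

(** Σ ϑ'(x a) ⊗ b y = Σ ϑ'(x) a ⊗ b y = Σ a ⊗ b ϑ'(x) y. On e' this yields Σ ϑ'(c) ⊗ d = Σ a ⊗ b,
    needed for the Nakayama automorphisms. *)
Lemma spread_forml l r T (x : hom T _) :
  ap l th (S :: r) (ap l spread r x) =
  ap (R :: l) mS r (ap (R :: l) i (S :: r) (ap l eR (S :: r)
    (ap l contrl r x))).
Proof.
move: l r T x; from_base; apply: wquot_epi; nested.
rewrite spreadE spread_quotE contrlE.
xch th mS; rewrite wlinr; xch th i; xch th eR; xch mR i.
rewrite wfelt_casimir wextM.
xch eR mS; xch eR i; xch i mS.
by rewrite wmulA.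
Qed.

Lemma spread_tracel l r T (x : hom T _) :
  ap l tR (S :: r) (ap l th (S :: r) (ap l spread r x)) = ap l contrl r x.
Proof.
rewrite spread_forml; xch tR mS; xch tR i.
by rewrite wform_feltl wext1 wmul1m.
Qed.

Lemma spread_tracer l r T (x : hom T _) :
  ap (S :: l) tR r (ap (S :: l) th r (ap l spread r x)) = ap l contrr r x.
Proof.
move: l r T x; from_base; apply: wquot_epi; nested.
rewrite spreadE spread_quotE contrrE.
xch i i; xch mS i; rewrite wlinl; xch th mS; xch th i; xch th eR.
xch mR mS; xch tR mS; xch mR i; xch tR i.
by rewrite felt_snaker.
Qed.

Lemma frobenius_of_extension (e : whom [::] [:: SS]) :
  ext_lact cq cofl ia ∘ (idm S ⊠ e) ∘ ρ' =
  ext_ract cq cofl ia ∘ (e ⊠ idm S) ∘ λ' ->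
  contrr ∘ e = eta Salg -> contrl ∘ e = eta Salg ->
  exists pS : frobenius_pair Salg, nakayama sv pS ∘ ia = ia ∘ nakayama sv pR.
Proof.
move=> cas er el.
have wcas : ap [::] wlact [::] (ap [:: S] e [::] (idm (wob [:: S]))) =
    ap [::] wract [::] (ap [::] e [:: S] (idm (wob [:: S]))).
  by heq_of cas.
have wer l r T (x : hom T _) : ap l contrr r (ap l e r x) = ap l uS r x.
  by rewrite -ap_comp er.
have wel l r T (x : hom T _) : ap l contrl r (ap l e r x) = ap l uS r x.
  by rewrite -ap_comp el.
case: (@frobenius_pair_exists _ Salg (tR ∘ th)
  (spread ∘ e : whom [::] [:: S; S])).
- by rewrite !ap_comp -spread_lact -spread_ract wcas.
- by rewrite !ap_comp spread_tracel wel.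
- by rewrite !ap_comp spread_tracer wer.
move=> pS [tE eE]; exists pS.
suff E : (wnak sv pS ∘ i : whom [:: R] [:: S]) = i ∘ wnak sv pR by exact: E.
apply: ap_inj; rewrite [LHS]ap_comp [RHS]ap_comp.
apply: (@nakayama_commute _ sv _ _ _ _ _ th) => l r T x.
  by rewrite tE ap_comp wlinr.
rewrite eE ap_comp spread_forml wel.
by xch eR uS; xch i uS; rewrite wmulm1.
Qed.

End To_frobenius.
End Relative_form.

Lemma extension_of_frobenius (pR : frobenius_pair Ralg)
    (pS : frobenius_pair Salg) :
  separable Ralg -> nakayama sv pS ∘ ia = ia ∘ nakayama sv pR ->
  frobenius_extension cq cofl ia.
Proof.
case=> g [gl gr mg] nakE.
have thl : left_linear (Y := lS) (Y' := left_regular Ralg) (rel_form pR pS).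
  have := @rel_form_linl pR pS nakE [::] [::] _ (idm (wob [:: R; S])).
  rewrite /left_linear /= compA; move: (rel_form pR pS) => k H.
  by heq_of H.
have thr : right_linear (X := rS) (X' := right_regular Ralg) (rel_form pR pS).
  have := @rel_form_linr pR pS [::] [::] _ (idm (wob [:: S; R])).
  rewrite /right_linear /= compA; move: (rel_form pR pS) => k H.
  by heq_of H.
(* Only these three properties of the lift are used, so it is made abstract. *)
have [b [bcas bl br]] : exists b : whom [::] [:: S; S],
    [/\ forall l r T (x : hom T _), ap l mS (S :: r) (ap (S :: l) b r x) =
          ap (S :: l) mS r (ap l b (S :: r) x),
        forall l r T (x : hom T _), ap l mS r (ap l i (S :: r)
          (ap l (rel_form pR pS) (S :: r) (ap l b r x))) = ap l uS r x
      & forall l r T (x : hom T _), ap l mS r (ap (S :: l) i r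
          (ap (S :: l) (rel_form pR pS) r (ap l b r x))) = ap l uS r x].
  exists (rel_felt pR pS g); split=> l r T x.
  - exact: rel_felt_casimir.
  - exact: rel_felt_forml.
  - exact: rel_felt_formr.
exists (rel_form pR pS), thl, thr, (q ∘ b : whom [::] [:: SS]); split.
- have H : ap [::] wlact [::] (ap [:: S] (q ∘ b : whom [::] [:: SS]) [::]
      (idm (wob [:: S]))) =
    ap [::] wract [::] (ap [::] (q ∘ b : whom [::] [:: SS]) [:: S]
      (idm (wob [:: S]))).
    by rewrite !ap_comp wlactE wractE bcas.
  move: (q ∘ b : whom [::] [:: SS]) H => e H; by heq_of H.
- apply/(contrr_elt thl)/ap_inj; rewrite !ap_comp contrrE.
  by rewrite br.
- apply/(contrl_elt thr)/ap_inj; rewrite !ap_comp contrlE.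
  by rewrite bl.
Qed.

End Relative_tensor.
End Extension.

Theorem theorem5p11 (C : strict_monoidal_category) (sv : sovereign C)
    (cq : coequalizers C)
    (cofl : forall X : C, coflat X)
    (rob : forall (R : algebra C) (Y : left_module R), left_robust cq Y)
    (R S : algebra C) (frobR : frobenius R) (sepR : separable R)
    (i : algebra_morphism R S) :
  frobenius_extension cq cofl i <->
  (frobenius S /\
   exists (pS : frobenius_pair S) (pR : frobenius_pair R),
     nakayama sv pS ∘ i = i ∘ nakayama sv pR).
Proof.
split=> [[th [thl [thr [e [cas er el]]]]]|[_ [pS [pR nakE]]]].
  (* Any Frobenius pair of R will do: the pair of S is built from it. *)
  case: frobR => pR.
  have [pS nakE] := frobenius_of_extension sv pR cas
    (proj1 (contrr_elt thl e) er) (proj1 (contrl_elt thr e) el).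
  by split; [|exists pS, pR].
exact: (extension_of_frobenius cq cofl sepR nakE).
Qed.
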